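(* Let $H$ be the graph with vertex set $\{u,v,a,b,c,d\}$ and edge set $\{uv, ua, ub, vc, vd\}$. Let $\beta \in \left[0,\frac16\right]$ be a real number. Then, for integers $n\ge 0$, $$\mathrm{ex}(n,\beta n\cdot H) = \left(\Xi(\beta)+o(1)\right)n^2,$$ where $o(1)\to 0$ as $n\to\infty$ (with $\beta$ fixed) and $$\Xi(\beta) = \begin{cases} 3\beta(1-3\beta), & \text{if } \beta\in\left[0,\frac19\right],\\[0.3em] 18\beta^2, & \text{if } \beta\in\left[\frac19,\frac16\right].\end{cases}$$
   Context: All graphs are finite and simple. For graphs $F$ and $G$, an $F$-tiling in $G$ is a collection of vertex-disjoint copies of $F$ in $G$ (copies are subgraphs, not necessarily induced); its size is the number of copies. The $F$-matching number $\nu(F,G)$ is the maximum size of an $F$-tiling in $G$. For a real number $x$, $\mathrm{ex}(n, x\cdot F)$ denotes the maximum number of edges in an $n$-vertex graph $G$ with $\nu(F,G)<x$; thus $\mathrm{ex}(n,\beta n\cdot H)$ is the maximum number of edges in an $n$-vertex graph $G$ with $\nu(H,G)<\beta n$. In the degenerate case $\beta=0$, where no such graph exists, the maximum is taken to be $0$. *)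

(* Defs.v *)
From HB Require Import structures.
From mathcomp Require Import all_boot all_order all_algebra reals.

Set Implicit Arguments.
Unset Strict Implicit.
Unset Printing Implicit Defensive.

Import Order.TTheory GRing.Theory Num.Theory.

(* A finite simple graph with vertex set T; edges are two-element sets. *)
Record sgraph (T : finType) := SGraph {
  edges : {set {set T}};
  edges_card2 : [forall e in edges, #|e| == 2]
}.

HB.instance Definition _ (T : finType) := [isSub for @edges T].
HB.instance Definition _ (T : finType) := [Countable of sgraph T by <:].
HB.instance Definition _ (T : finType) := [Finite of sgraph T by <:].

Section Tilings.
Variables (V T : finType) (F : sgraph V) (G : sgraph T).

(* A subgraph of G is represented by the pair (vertex set, edge set). *)
Definition is_copy (S : {set T} * {set {set T}}) : bool :=
  [exists f : {ffun V -> T},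
    [&& injectiveb f,
        S.1 == f @: [set: V],
        S.2 == [set f @: (e : {set V}) | e in edges F]
      & S.2 \subset edges G]].

Definition is_tiling (P : {set {set T} * {set {set T}}}) : bool :=
  [forall S in P, is_copy S] &&
  [forall S1 in P, forall S2 in P, (S1 != S2) ==> [disjoint S1.1 & S2.1]].

Definition nu : nat :=
  \max_(P : {set {set T} * {set {set T}}} | is_tiling P) #|P|.

End Tilings.

(* The maximum over an empty family of graphs is 0. *)
Definition ex_tiling (R : realType) (V : finType) (F : sgraph V)
    (n : nat) (x : R) : nat :=
  \max_(G : sgraph 'I_n | ((nu F G)%:R < x)%R) #|edges G|.

Definition vu : 'I_6 := @Ordinal 6 0 isT.
Definition vv : 'I_6 := @Ordinal 6 1 isT.
Definition va : 'I_6 := @Ordinal 6 2 isT.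
Definition vb : 'I_6 := @Ordinal 6 3 isT.
Definition vc : 'I_6 := @Ordinal 6 4 isT.
Definition vd : 'I_6 := @Ordinal 6 5 isT.

Definition H_edges : {set {set 'I_6}} :=
  [set [set vu; vv]; [set vu; va]; [set vu; vb]; [set vv; vc]; [set vv; vd]].

Lemma H_edges_card2 : [forall e in H_edges, #|e| == 2].
Proof.
apply/forall_inP => e; rewrite !inE -!orbA.
by case/or4P => [||| /orP[]] /eqP ->; rewrite cards2.
Qed.

Definition H : sgraph 'I_6 := SGraph H_edges_card2.

(* The two formulas agree at 1/9. *)
Definition Xi (R : realType) (beta : R) : R :=
  (if beta <= 1 / 9 then 3 * beta * (1 - 3 * beta) else 18 * beta ^+ 2)%R.

(* Main.v *)
Require Import Defs.
From mathcomp Require Import all_boot all_order all_algebra.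
From mathcomp Require Import all_classical all_reals all_analysis.
From mathcomp Require Import fintype finset.
From mathcomp Require Import zify ring lra.

(** Why the theorem is true.

    Let [k] be the size of a largest tiling of an [n]-vertex graph by copies
    of [H]; call these [k] copies tiles and let [U] be the set of the
    [u = n - 6k] uncovered vertices.  Two features of [H] matter.  It has a
    proper 2-colouring with two classes of size three, so it is contained in
    [K_{3,3}]; and an edge whose two ends have many neighbours elsewhere is the
    central edge of a copy all of whose leaves lie elsewhere.

    Lower bound.  In [K_{3k,n-3k}] every copy of [H] takes three vertices of
    the first part, and in a clique on [6k] vertices with isolated vertices
    added it takes six clique vertices; so neither graph has more than [k]
    disjoint copies ([bipartite_extremal], [clique_extremal]).  With [k] the
    largest integer below [beta * n] they give the two branches of [Xi].

    Upper bound.  The edges inside [U] are few, as a dense graph contains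
    [K_{3,3}] and the tiling could be enlarged ([uncovered_sparse]).  The heart
    of the proof is a local inequality: for all but [o(n^3)] triples formed by
    two tiles [T], [T'] and an uncovered vertex [y], one has
    [deg_T(y) <= 3], [deg_T'(y) <= 3] and
    [e(T,T') + 3 deg_T(y) + 3 deg_T'(y) <= 36] ([few_dense_triples]).  If [a]
    counts the ordered adjacent pairs of covered vertices and [b] the edges
    between [U] and the tiles, then summing over all triples gives
    [a u + 6 k b <= 36 k^2 u + o(n^3)] and [k b <= 3 k^2 u + o(n^3)].  Hence
    [a/2 + b] is at most [18 k^2] when [u <= 3k] and at most [3k(n-3k)] when
    [u >= 3k], up to [o(n^2)], and both are at most [Xi(beta) n^2] in their
    ranges.

    The local inequality.  If it fails for many triples, then many of them show
    the same adjacency pattern, and two applications of the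
    Kovari-Sos-Turan argument ([dense_common_neighbours]) produce tiles
    [T_1, T_2, ...], tiles [T'_1, T'_2, ...] and a large set [Y] of uncovered
    vertices such that all triples [(T_i, T'_j, y)] have this pattern.  Let [P]
    be the bipartite graph of the pattern between the six vertices of a tile of
    the first kind and the six of the second kind, and let [B] and [B'] be the
    vertices of the two tiles that are joined to [Y].  Take [3 th] tiles of the
    first kind and [3 th'] of the second and cover them afresh.  Joining the
    vertices of [B] and [B'] to [Y] in copies of [K_{3,3}] yields
    [th |B| + th' |B'|] copies of [H].  An edge of [P] that avoids both [B] and
    [B'] gives further copies of [K_{3,3}], and an edge of [P] between [B] and
    [B'] can serve as central edge of copies with all leaves in [Y], which
    consume two vertices of the tiles in place of three.  Per unit of a
    matching in these two sorts of edges, with capacities [th] and [th'] at the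
    vertices, one copy is gained ([pattern_packing]).  Since the tiling is
    maximum, no matching reaches [(3-|B|) th + (3-|B'|) th' + 1]; by the theorem
    of Konig in its capacitated form ([bmatching_of_covers]) there is then a
    cheap vertex cover, which bounds the number of edges of [P].  For a suitable
    ratio [th : th'], depending on [|B|] and [|B'|], the bound is the local
    inequality ([dense_pattern_bmatching]). *)

Set Implicit Arguments.
Unset Strict Implicit.
Unset Printing Implicit Defensive.

Import Order.TTheory GRing.Theory Num.Theory.
Import numFieldNormedType.Exports.

(** * Bipartite b-matchings and vertex covers *)

Section Konig.
Variables (A B : finType) (E : A -> B -> bool).

Definition is_cover (C : {set A}) (C' : {set B}) :=
  forall a b, E a b -> (a \in C) || (b \in C').

Definition cover_cost (ca : A -> nat) (cb : B -> nat) (C : {set A}) (C' : {set B}) :=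
  \sum_(a in C) ca a + \sum_(b in C') cb b.

Definition is_bmatching (ca : A -> nat) (cb : B -> nat) (F : A -> B -> nat) :=
  [/\ forall a b, 0 < F a b -> E a b,
      forall a, \sum_b F a b <= ca a &
      forall b, \sum_a F a b <= cb b].

Lemma cover_join C1 C1' C2 C2' : is_cover C1 C1' -> is_cover C2 C2' ->
  is_cover (C1 :|: C2) (C1' :&: C2').
Proof.
move=> h1 h2 a b e; move: (h1 _ _ e) (h2 _ _ e); rewrite !inE.
by do 4! case: (_ \in _).
Qed.

Lemma cover_meet C1 C1' C2 C2' : is_cover C1 C1' -> is_cover C2 C2' ->
  is_cover (C1 :&: C2) (C1' :|: C2').
Proof.
move=> h1 h2 a b e; move: (h1 _ _ e) (h2 _ _ e); rewrite !inE.
by do 4! case: (_ \in _).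
Qed.

Lemma leq_sum_subset (T : finType) (f : T -> nat) (X Y : {set T}) :
  X \subset Y -> \sum_(x in X) f x <= \sum_(x in Y) f x.
Proof.
move=> /subsetP sXY; rewrite !(big_mkcond (fun x => x \in _)); apply: leq_sum => x _.
by case: ifP => // /sXY ->.
Qed.

Lemma sumUI (T : finType) (f : T -> nat) (X Y : {set T}) :
  \sum_(x in X :|: Y) f x + \sum_(x in X :&: Y) f x
  = \sum_(x in X) f x + \sum_(x in Y) f x.
Proof.
rewrite !(big_mkcond (fun x => x \in _)) -!big_split /=.
by apply: eq_bigr => x _; rewrite !inE; do 2! case: (_ \in _); rewrite ?addn0 ?add0n.
Qed.

(** Joins and meets of covers are covers again; with this identity the covers of
    least cost form a lattice. *)
Lemma cover_cost_submodular ca cb C1 C1' C2 C2' :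
  cover_cost ca cb (C1 :|: C2) (C1' :&: C2') + cover_cost ca cb (C1 :&: C2) (C1' :|: C2')
  = cover_cost ca cb C1 C1' + cover_cost ca cb C2 C2'.
Proof.
have := sumUI ca C1 C2; have := sumUI cb C1' C2'; rewrite /cover_cost; lia.
Qed.

Definition decr (T : eqType) (c : T -> nat) (x : T) := fun y => c y - (y == x).

Lemma sum_decr (T : finType) (c : T -> nat) (x : T) (X : {set T}) : 0 < c x ->
  \sum_(y in X) c y = \sum_(y in X) decr c x y + (x \in X).
Proof.
move=> cx; have e y : c y = decr c x y + (y == x).
  by rewrite /decr subnK //; case: eqP => // ->.
rewrite (eq_bigr _ (fun y _ => e y)) big_split /=; congr (_ + _).
rewrite -big_mkcondr /= sum1dep_card; case: (boolP (x \in X)) => xX.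
  by rewrite (_ : [set _ | _] = [set x]) ?cards1 //; apply/setP=> y; rewrite !inE;
     case: eqP => [->|]; rewrite ?xX ?andbF.
rewrite (_ : [set _ | _] = set0) ?cards0 //; apply/setP=> y; rewrite !inE.
by case: eqP => [->|]; rewrite ?(negbTE xX) ?andbF.
Qed.

Lemma sum_eq1 (T : finType) (x : T) : \sum_y (y == x : nat) = 1.
Proof. by rewrite (bigD1 x) //= eqxx big1 // => y /negbTE ->. Qed.

Lemma sum_andl (T : finType) (c : bool) (x : T) : \sum_y (c && (y == x) : nat) = c.
Proof. by case: c; rewrite /= ?sum_eq1 ?big1. Qed.

Lemma sum_andr (T : finType) (c : bool) (x : T) : \sum_y ((y == x) && c : nat) = c.
Proof. by under eq_bigr do rewrite andbC; rewrite sum_andl. Qed.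

(** The capacitated theorem of Konig, by induction on the target [c].  If some edge
    [ab] can carry one unit without making a cover cheaper than [c - 1], spend it.
    Otherwise every edge with capacity left lies in a cheapest cover containing
    both of its ends.  Among the cheapest covers with a vertex of positive capacity
    on the left take one with smallest left part [C0]; some edge [ab] leaves [C0]
    towards a vertex outside the right part, and joining with a cheapest cover that
    contains both [a] and [b] drops [b] and costs less than the minimum. *)
Theorem bmatching_of_covers c ca cb :
  (forall C C', is_cover C C' -> c <= cover_cost ca cb C C') ->
  exists2 F, is_bmatching ca cb F & \sum_a \sum_b F a b = c.
Proof.
elim: c ca cb => [|c IH] ca cb hc.
  exists (fun _ _ => 0); last by rewrite big1 // => a _; rewrite big1.
  by split=> // x; rewrite big1.
have [/existsP[[a b] /= /and4P[eab ca0 cb0 /forallP hred]]|] :=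
  boolP [exists p : A * B, [&& E p.1 p.2, 0 < ca p.1, 0 < cb p.2 &
    [forall q : {set A} * {set B},
      [forall a, forall b, E a b ==> (a \in q.1) || (b \in q.2)] ==>
      (c <= cover_cost (decr ca p.1) (decr cb p.2) q.1 q.2)]]].
  have [|F [FE Fa Fb] Fc] := IH (decr ca a) (decr cb b).
    move=> C C' hC; have /implyP := hred (C, C'); apply.
    by apply/forallP=> x; apply/forallP=> y; apply/implyP; apply: hC.
  exists (fun x y => F x y + ((x == a) && (y == b))).
    split=> [x y|x|y].
    - by case: (eqVneq x a) => [->|_]; case: (eqVneq y b) => [->|_] //=;
        rewrite ?addn0 => h; try exact: FE.
    - rewrite big_split /= sum_andl; have := Fa x; rewrite /decr; case: eqP => [->|_]; lia.
    - rewrite big_split /= sum_andr; have := Fb y; rewrite /decr; case: eqP => [->|_]; lia.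
  under eq_bigr do rewrite big_split /= sum_andl.
  by rewrite big_split /= Fc sum_eq1 addn1.
rewrite negb_exists => /forallP hno.
(* No edge can be spent: reducing both ends makes some cover too cheap, so this
   cover contains both ends and was a cheapest one. *)
have tight a b : E a b -> 0 < ca a -> 0 < cb b -> exists C C',
    [/\ is_cover C C', a \in C, b \in C' & cover_cost ca cb C C' = c.+1].
  move=> eab ca0 cb0; have := hno (a, b); rewrite /= eab ca0 cb0 /=.
  rewrite negb_forall => /existsP[[C C'] /=]; rewrite negb_imply -ltnNge.
  case/andP=> /forallP h lt.
  have hC : is_cover C C' by move=> x y; have /forallP/(_ y)/implyP := h x.
  have ge := hc _ _ hC; move: lt ge; rewrite /cover_cost.
  rewrite (sum_decr C ca0) (sum_decr C' cb0) => lt ge; exists C, C'.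
  rewrite /cover_cost (sum_decr C ca0) (sum_decr C' cb0).
  by move: lt ge; case: (a \in C); case: (b \in C'); split=> //; lia.
pose good (q : {set A} * {set B}) :=
  [&& [forall a, forall b, E a b ==> (a \in q.1) || (b \in q.2)],
      cover_cost ca cb q.1 q.2 == c.+1 & [exists a in q.1, 0 < ca a]].
have [q0 hq0] : exists q, good q.
  have [/existsP[[a b] /and3P[/= eab ca0 cb0]]|] :=
    boolP [exists p : A * B, [&& E p.1 p.2, 0 < ca p.1 & 0 < cb p.2]].
    have [C [C' [hC aC bC' e]]] := tight _ _ eab ca0 cb0.
    exists (C, C'); rewrite /good /= e eqxx /=; apply/andP; split.
      by apply/forallP=> x; apply/forallP=> y; apply/implyP; apply: hC.
    by apply/existsP; exists a; rewrite aC.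
  rewrite negb_exists => /forallP h0.
  have := hc [set a | ca a == 0] [set b | cb b == 0].
  rewrite /cover_cost !big1 => [h|b|a]; try by rewrite inE => /eqP.
  suff: is_cover [set a | ca a == 0] [set b | cb b == 0] by move/h.
  move=> a b eab; have := h0 (a, b); rewrite /= eab /= !inE; lia.
case: (arg_minnP (fun q : {set A} * {set B} => #|q.1|) hq0) => -[C0 C0'] /=.
case/and3P=> /= /forallP h0 /eqP e0 /existsP[a /andP[aC0 ca0]] min0.
have hC0 : is_cover C0 C0' by move=> x y; have /forallP/(_ y)/implyP := h0 x.
have [/existsP[b /and3P[eab bC0 cb0]]|] :=
    boolP [exists b, [&& E a b, b \notin C0' & 0 < cb b]]; last first.
  rewrite negb_exists => /forallP hb.
  have /hc : is_cover (C0 :\ a) (C0' :|: [set b | cb b == 0]).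
    move=> x y exy; rewrite !inE; have := hC0 _ _ exy; have := hb y.
    case: (eqVneq x a) exy => [->->|_ _ _] /=; last by case: (y \in C0'); case: (x \in C0).
    by case: (y \in C0') => //=; case: (cb y).
  have := sumUI cb C0' [set b | cb b == 0].
  rewrite (big1 (index_enum B) (fun b => b \in [set b | cb b == 0])) => [|b].
    move: e0; rewrite /cover_cost (big_setD1 a aC0) /=; lia.
  by rewrite inE => /eqP.
have [C1 [C1' [hC1 aC1 bC1 e1]]] := tight _ _ eab ca0 cb0.
have sub := cover_cost_submodular ca cb C0 C0' C1 C1'.
have jn := hc _ _ (cover_join hC0 hC1); have mt := hc _ _ (cover_meet hC0 hC1).
have emt : cover_cost ca cb (C0 :&: C1) (C0' :|: C1') = c.+1 by lia.
have ejn : cover_cost ca cb (C0 :|: C1) (C0' :&: C1') = c.+1 by lia.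
have sC : C0 \subset C1.
  have := min0 (C0 :&: C1, C0' :|: C1'); rewrite /good /= emt eqxx /= => hm.
  apply/setIidPl/eqP; rewrite eqEcard subsetIl hm //; apply/andP; split.
    apply/forallP=> x; apply/forallP=> y; apply/implyP; exact: cover_meet.
  by apply/existsP; exists a; rewrite inE aC0 aC1.
move: ejn; rewrite (setUidPr sC) -e1 /cover_cost (big_setD1 b bC1) /=.
have : \sum_(i in C0' :&: C1') cb i <= \sum_(i in C1' :\ b) cb i.
  apply: leq_sum_subset; apply/subsetP=> x; rewrite !inE => /andP[xC0 ->].
  by rewrite andbT; apply: contraNneq bC0 => <-.
lia.
Qed.
End Konig.

(** * Dense patterns between two tiles *)

(** [P] is the adjacency between two tiles, [B] and [B'] are their vertices joined to
    the uncovered set.  The edges whose use gains a copy of [H] are those joining [B]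
    to [B'] (as central edges) and those joining the complements (inside [K_{3,3}]);
    on the remaining edges one end is already used at full value. *)
Definition useful (P : rel 'I_6) (B B' : {set 'I_6}) : rel 'I_6 :=
  fun x y => P x y && ((x \in B) == (y \in B')).

(** The negation is the local inequality. *)
Definition dense_pattern (P : rel 'I_6) (B B' : {set 'I_6}) :=
  [|| 3 < #|B|, 3 < #|B'| | 36 < \sum_x \sum_y P x y + 3 * #|B| + 3 * #|B'|].

(** The number of tiles of the first kind, in units of three, when [|B| = i] and
    [|B'| = j]; the second kind uses [capacity j i].  The kind with more attached
    vertices is taken more often: each of its other vertices covers more edges, and
    the larger capacity makes it dearer in a cover. *)
Definition capacity (i j : nat) :=
  if i == j then 1 else if i == 3 then 4 else if j == 3 then 1 else if j < i then 4 else 3.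

(** The numerical content of the local inequality: [s], [s'], [b], [b'] count the
    vertices outside a cheap cover, in the complement of [B], the complement of [B'],
    in [B] and in [B'].  The pattern has no edges among the
    [s * s' + b * b'] corresponding pairs. *)
Lemma capacity_check (i j s s' b b' : nat) : i <= 3 -> j <= 3 ->
  s <= 6 - i -> s' <= 6 - j -> b <= i -> b' <= j ->
  capacity i j * (3 + i) + capacity j i * (3 + j) <=
    capacity i j * (s + b) + capacity j i * (s' + b') ->
  3 * (i + j) <= s * s' + b * b'.
Proof.
pose ok i j s s' b b' := [|| 6 - i < s, 6 - j < s', i < b, j < b',
  capacity i j * (s + b) + capacity j i * (s' + b') <
  capacity i j * (3 + i) + capacity j i * (3 + j) | 3 * (i + j) <= s * s' + b * b'].
have h : all (fun i => all (fun j => all (fun s => all (fun s' => all (fun b =>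
  all (fun b' => ok i j s s' b b') (iota 0 4)) (iota 0 4)) (iota 0 7)) (iota 0 7))
    (iota 0 4)) (iota 0 4) by vm_compute.
move=> hi hj hs hs' hb hb' hc.
have mi m x : x < m -> x \in iota 0 m by rewrite mem_iota.
have := allP (allP (allP (allP (allP (allP h i (mi _ _ _)) j (mi _ _ _)) s (mi _ _ _))
  s' (mi _ _ _)) b (mi _ _ _)) b' (mi _ _ _).
move=> /(_ ltac:(lia) ltac:(lia) ltac:(lia) ltac:(lia) ltac:(lia) ltac:(lia)).
rewrite /ok; lia.
Qed.

Lemma sum_pairs_card (P : rel 'I_6) :
  \sum_x \sum_y (P x y : nat) = #|[set p : 'I_6 * 'I_6 | P p.1 p.2]|.
Proof.
rewrite pair_bigA /= -sum1dep_card [RHS]big_mkcond /=.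
by apply: eq_bigr => p _; case: (P _ _).
Qed.

(** In a dense pattern [th] and [th'] can be chosen so that [3 th] tiles of one kind
    and [3 th'] of the other can be replaced by more than [3 th + 3 th'] copies:
    a cover cheap enough to forbid this misses too many pairs. *)
Theorem dense_pattern_bmatching P B B' : dense_pattern P B B' ->
  exists th th' F, [/\ th <= 4, th' <= 4,
    is_bmatching (useful P B B') (fun=> th) (fun=> th') F &
    3 * th + 3 * th' < th * #|B| + th' * #|B'| + \sum_x \sum_y F x y].
Proof.
have triv (th th' : nat) : is_bmatching (useful P B B') (fun=> th) (fun=> th') (fun _ _ => 0).
  by split=> // x; rewrite big1.
move=> dense.
(* Four attached vertices: three tiles of one kind already give four copies. *)
have [hB|hB] := ltnP 3 #|B|; first by exists 1, 0, (fun _ _ => 0); split=> //; lia.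
have [hB'|hB'] := ltnP 3 #|B'|; first by exists 0, 1, (fun _ _ => 0); split=> //; lia.
have big : 36 < \sum_x \sum_y P x y + 3 * #|B| + 3 * #|B'|.
  by move: dense; rewrite /dense_pattern ltnNge hB ltnNge hB'.
set i := #|B| in big hB *; set j := #|B'| in big hB' *.
pose th := capacity i j; pose th' := capacity j i.
have [F hF eF] : exists2 F, is_bmatching (useful P B B') (fun=> th) (fun=> th') F &
    \sum_x \sum_y F x y = (3 * th + 3 * th').+1 - (th * i + th' * j).
  apply: bmatching_of_covers => C C' hC.
  rewrite leqNgt; apply/negP => lt.
  move: lt; rewrite /cover_cost !sum_nat_const => lt.
  have cX (X D : {set 'I_6}) : #|X :\: D| + #|X :&: D| = #|X|.
    by rewrite addnC cardsID.
  have := cX B C; have := cX (~: B) C; have := cX B' C'; have := cX (~: B') C'.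
  have := cardsC B; have := cardsC B'; rewrite !card_ord -/i -/j => cB' cB.
  have cC (X D : {set 'I_6}) : #|D :&: X| + #|~: D :&: X| = #|X|.
    by rewrite ![_ :&: X]setIC -setDE addnC addnC cardsID.
  have := cC C B; have := cC C' B'; rewrite -/i -/j.
  have cp : #|[set p : 'I_6 * 'I_6 | P p.1 p.2]| + #|setX (~: B :\: C) (~: B' :\: C')|
      + #|setX (B :\: C) (B' :\: C')| <= 36.
    set Q := [set p | _]; set X1 := setX _ _; set X2 := setX _ _.
    have d12 : X1 :&: X2 = set0.
      by apply/setP=> -[x y]; rewrite !inE /=; case: (x \in B); rewrite ?andbF.
    have sub : X1 :|: X2 \subset ~: Q.
      apply/subsetP=> -[x y]; rewrite !inE /= => h; apply/negP=> pxy.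
      have := hC x y; rewrite /useful pxy /=; move: h.
      by do 4! case: (_ \in _) => //=; move=> _ /(_ isT).
    have le : #|X1| + #|X2| <= #|~: Q|.
      by rewrite -cardsUI d12 cards0 addn0; apply: subset_leq_card.
    rewrite -addnA; apply: leq_trans (leq_add (leqnn _) le) _.
    by rewrite cardsC card_prod !card_ord.
  move: cp; rewrite !cardsX -sum_pairs_card.
  set s1 := #|~: B :\: C|; set s2 := #|~: B' :\: C'|.
  set b1 := #|B :\: C|; set b2 := #|B' :\: C'| => cp.
  move: lt; set c1 := #|C|; set c2 := #|C'| => lt.
  set m1 := #|B :&: C|; set m2 := #|B' :&: C'|.
  move=> h1 h2 h3 h4 h5 h6.
  have e1 : s1 + b1 + c1 = 6 by lia.
  have e2 : s2 + b2 + c2 = 6 by lia.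
  suff : 3 * (i + j) <= s1 * s2 + b1 * b2 by lia.
  apply: (@capacity_check i j s1 s2 b1 b2 hB hB'); [lia|lia|lia|lia|].
  have p1 : th * (s1 + b1) + th * c1 = th * 6 by rewrite -mulnDr e1.
  have p2 : th' * (s2 + b2) + th' * c2 = th' * 6 by rewrite -mulnDr e2.
  have q1 : th * i <= th * 3 by rewrite leq_mul2l hB orbT.
  have q2 : th' * j <= th' * 3 by rewrite leq_mul2l hB' orbT.
  by rewrite -/th -/th' (mulnDr th 3) (mulnDr th' 3); lia.
exists th, th', F; split=> //; try by rewrite /th /th' /capacity; do ! case: ifP.
rewrite eF; lia.
Qed.

(** * Common neighbourhoods in dense relations *)

Lemma subset_of_card (T : finType) (X : {set T}) m :
  m <= #|X| -> exists2 Y : {set T}, Y \subset X & #|Y| = m.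
Proof.
move=> hm; exists [set x in take m (enum X)].
  by apply/subsetP=> x; rewrite inE => /mem_take; rewrite mem_enum.
rewrite cardsE (card_uniqP _) ?take_uniq ?enum_uniq // size_takel //.
by rewrite -cardE.
Qed.

Lemma sum_card (T : finType) (P : pred T) (X : {set T}) :
  \sum_(x in X) (P x : nat) = #|[set x in X | P x]|.
Proof.
rewrite -sum1dep_card [RHS]big_mkcondr /=.
by apply: eq_bigr => x _; case: (P x).
Qed.

Lemma sum_cardT (T : finType) (P : pred T) : \sum_x (P x : nat) = #|[set x | P x]|.
Proof. by rewrite -sum1dep_card [RHS]big_mkcond; apply: eq_bigr => x _; case: (P x). Qed.

(** From a relation of density [1 / D] one gets [s] left-hand vertices whose common
    neighbourhood keeps the fraction [1 / kst_const s D] of the right-hand side. *)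
Definition kst_const s D := 2 * D * s * 2 ^ (2 * D * s).

Lemma kst_const_gt0 s D : 0 < s -> 0 < D -> 0 < kst_const s D.
Proof. by move=> s0 D0; rewrite /kst_const !muln_gt0 s0 D0 expn_gt0. Qed.

(** The Kovari-Sos-Turan argument.  A constant number [m = 2 D s] of vertices of
    large degree has on average at least [s] of its members adjacent to a vertex
    of [B]; a positive fraction of [B] therefore sees [s] of them, and some
    [s]-subset of the [m] vertices is seen by a positive fraction of [B]. *)
Theorem dense_common_neighbours (A B : finType) (R : A -> B -> bool) (s D NA NB : nat) :
  0 < s -> 0 < D -> #|A| <= NA -> #|B| <= NB -> 0 < NB ->
  2 * D * (2 * D * s) <= NA ->
  NA * NB <= D * \sum_a \sum_b R a b ->
  exists2 S : {set A}, #|S| = s &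
    NB <= kst_const s D * #|[set b | [forall a in S, R a b]]|.
Proof.
move=> s0 D0 hA hB NB0 hNA dens.
pose d a := \sum_b R a b.
have dle a : d a <= NB.
  by rewrite /d sum_cardT; apply: leq_trans hB; apply: max_card.
pose good := [set a | NB <= 2 * D * d a].
pose m := 2 * D * s.
have good_big : m <= #|good|.
  have h1 : 2 * D * \sum_a d a <= 2 * D * NB * #|good| + NA * NB.
    rewrite (bigID (mem good)) /= mulnDr leq_add //.
      rewrite -(mulnA _ NB) leq_mul2l; apply/orP; right.
      by rewrite mulnC -sum_nat_const; apply: leq_sum.
    rewrite big_distrr /=; apply: (@leq_trans (\sum_(a | a \notin good) NB)).
      by apply: leq_sum => a; rewrite inE -ltnNge => /ltnW.
    rewrite sum_nat_const leq_mul2r; apply/orP; right.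
    by apply: leq_trans hA; apply: max_card.
  have : NA * NB <= 2 * D * #|good| * NB.
    have dens' : NA * NB <= D * \sum_a d a by [].
    by move: h1 dens'; rewrite -!mulnA [NB * _]mulnC; lia.
  rewrite leq_mul2r eqn0Ngt NB0 /= => h2.
  have : 2 * D * m <= 2 * D * #|good| by apply: leq_trans h2.
  by rewrite leq_mul2l => /orP[|//]; rewrite muln_eq0 /= eqn0Ngt D0.
have [A0 /subsetP sA0 cA0] := subset_of_card good_big.
pose e b := \sum_(a in A0) R a b.
have he : s * NB <= \sum_b e b.
  have : 2 * D * (s * NB) <= 2 * D * \sum_b e b.
    rewrite /e exchange_big big_distrr /= mulnA -/m -cA0 -sum_nat_const.
    by apply: leq_sum => a /sA0; rewrite inE.
  by rewrite leq_mul2l => /orP[|//]; rewrite muln_eq0 /= eqn0Ngt D0.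
pose rich := [set b | s <= e b].
have hrich : NB <= #|rich| * m.
  have : \sum_b e b <= #|rich| * m + NB * s.-1.
    rewrite (bigID (mem rich)) /= leq_add //.
      rewrite -sum_nat_const; apply: leq_sum => b _; rewrite -cA0 /e sum_card.
      by apply: subset_leq_card; apply/subsetP=> x; rewrite inE => /andP[].
    apply: (@leq_trans (\sum_(b | b \notin rich) s.-1)).
      by apply: leq_sum => b; rewrite inE -ltnNge => h; rewrite -ltnS prednK.
    rewrite sum_nat_const leq_mul2r; apply/orP; right.
    by apply: leq_trans hB; apply: max_card.
  move=> h; have := leq_trans he h; rewrite -{1}(prednK s0); nia.
pose c (S : {set A}) := #|[set b | [forall a in S, R a b]]|.
have [/existsP[S /andP[/eqP cS hS]]|] :=
  boolP [exists S : {set A}, (#|S| == s) && (NB <= kst_const s D * c S)].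
  by exists S.
rewrite negb_exists => /forallP none; exfalso.
have cov : #|rich| <= \sum_(S in powerset A0 | #|S| == s) c S.
  rewrite -sum_cardT; under [leqRHS]eq_bigr => S _ do rewrite /c -sum_cardT.
  rewrite exchange_big /=; apply: leq_sum => b _.
  case hb: (s <= e b) => //=; move: hb; rewrite /e sum_card => hb.
  have [S sS cS] := subset_of_card hb.
  have PS : (S \in powerset A0) && (#|S| == s).
    rewrite cS eqxx andbT inE; apply: subset_trans sS _.
    by apply/subsetP=> x; rewrite inE => /andP[].
  rewrite (bigD1 S) //= (_ : [forall a in S, R a b]) ?leq_addr //.
  by apply/forall_inP=> a /(subsetP sS); rewrite inE => /andP[].
have : kst_const s D * #|rich| <= 2 ^ m * NB.-1.
  apply: leq_trans (leq_mul (leqnn _) cov) _.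
  rewrite big_distrr /= -cA0 -card_powerset -sum_nat_const big_mkcondr /=.
  apply: leq_sum => S _; case: ifP => // cS.
  by have := none S; rewrite cS /= -ltnNge; case: (NB) NB0.
rewrite /kst_const -/m.
have : 0 < 2 ^ m by rewrite expn_gt0.
move: hrich NB0; set p := 2 ^ m; nia.
Qed.

(** * Packings in blow-ups *)

(** The copies of [H] are the injective maps with this property. *)
Definition H_hom (T : Type) (e : rel T) (f : 'I_6 -> T) :=
  [&& e (f vu) (f vv), e (f vu) (f va), e (f vu) (f vb), e (f vv) (f vc) & e (f vv) (f vd)].

Definition H_packing (T : finType) (e : rel T) (s : seq {ffun 'I_6 -> T}) :=
  all (fun f : {ffun 'I_6 -> T} => H_hom e f) s &&
  uniq (flatten [seq codom f | f : {ffun 'I_6 -> T} <- s]).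

(** Number of vertices that a copy mapped by [h] takes from class [q]. *)
Definition usage (Q : finType) (h : 'I_6 -> Q) (q : Q) := #|[set i | h i == q]|.

(** Vertices with the same image in the blow-up pattern are numbered in order and
    sent to the vertex of that rank in their class. *)
Lemma injective_lift (T Q : finType) (X : Q -> {set T}) (h : 'I_6 -> Q) :
  (forall q q' x, x \in X q -> x \in X q' -> q = q') ->
  (forall q, usage h q <= #|X q|) ->
  exists2 f : {ffun 'I_6 -> T}, injective f & forall i, f i \in X (h i).
Proof.
move=> disj hX.
have pos i : 0 < #|X (h i)|.
  by apply: leq_trans (hX _); apply/card_gt0P; exists i; rewrite inE.
have [x0 _] := card_gt0P (pos ord0).
pose rk (i : 'I_6) := #|[set j : 'I_6 | (j < i) && (h j == h i)]|.
have rk_lt i : rk i < size (enum (X (h i))).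
  rewrite -cardE; apply: leq_trans (hX _); apply: proper_card; apply/properP; split.
    by apply/subsetP=> j; rewrite !inE => /andP[].
  by exists i; rewrite !inE ?eqxx ?ltnn.
have rk_inj (i j : 'I_6) : i < j -> h i = h j -> rk i < rk j.
  move=> ij hij; apply: proper_card; apply/properP; split.
    by apply/subsetP=> l; rewrite !inE hij => /andP[/ltn_trans ->].
  by exists i; rewrite !inE ?ij ?hij ?ltnn ?eqxx.
exists [ffun i => nth x0 (enum (X (h i))) (rk i)]; last first.
  by move=> i; rewrite ffunE -mem_enum mem_nth.
move=> i j; rewrite !ffunE => eij.
have hij : h i = h j.
  by apply: (disj _ _ (nth x0 (enum (X (h i))) (rk i))); [|rewrite eij];
     rewrite -mem_enum mem_nth.
move/eqP: eij; rewrite hij nth_uniq ?enum_uniq // -?hij // => /eqP eij.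
apply/val_inj; case: (ltngtP i j) => // lt; have := rk_inj _ _ lt.
  by rewrite hij eij ltnn => /(_ erefl).
by rewrite hij eij ltnn => /(_ erefl).
Qed.

(** Disjoint copies can be chosen greedily: each copy removes from every class exactly
    the number of vertices announced by [usage]. *)
Theorem packing_of_blowup (T Q : finType) (e : rel T) (eQ : rel Q) (X : Q -> {set T})
    (hs : seq {ffun 'I_6 -> Q}) :
  (forall q q' x, x \in X q -> x \in X q' -> q = q') ->
  (forall q q' x y, eQ q q' -> x \in X q -> y \in X q' -> e x y) ->
  {in hs, forall h : {ffun 'I_6 -> Q}, H_hom eQ h} ->
  (forall q, \sum_(h <- hs) usage h q <= #|X q|) ->
  exists s, [/\ H_packing e s, size s = size hs &
    forall f i, f \in s -> exists q, (f : {ffun _ -> _}) i \in X q].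
Proof.
elim: hs X => [|h hs IH] X disj cmpl hom hX; first by exists [::]; split.
have [|f finj fX] := @injective_lift T Q X h disj.
  by move=> q; apply: leq_trans (hX q); rewrite big_cons leq_addr.
pose X' q := X q :\: [set x in codom f].
have [||||s [ps ss vs]] := IH X'.
- by move=> q q' x; rewrite !inE => /andP[_ xq] /andP[_ xq']; apply: disj xq xq'.
- by move=> q q' x y eq; rewrite !inE => /andP[_ xq] /andP[_ xq']; apply: cmpl xq xq'.
- by move=> g gs; apply: hom; rewrite inE gs orbT.
- move=> q; have := hX q; rewrite big_cons.
  have : #|X q :&: [set x in codom f]| <= usage h q.
    rewrite /usage -(card_imset _ finj); apply: subset_leq_card.
    apply/subsetP=> x; rewrite !inE => /andP[xq /codomP[i xi]].
    rewrite xi imset_f // inE; apply/eqP; apply: disj (fX i) _; by rewrite -xi.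
  have := cardsID [set x in codom f] (X q); rewrite -/(X' q); lia.
exists (f :: s); split=> /=; last 2 first.
- by rewrite ss.
- move=> g i; rewrite inE => /orP[/eqP ->|/vs]; first by exists (h i).
  by move=> /(_ i) [q]; rewrite inE => /andP[_]; exists q.
case/andP: ps => ps us; rewrite /H_packing /= ps andbT cat_uniq us andbT.
have /and5P[h1 h2 h3 h4 h5] : H_hom eQ h by apply: hom; rewrite inE eqxx.
apply/and3P; split.
- by rewrite /H_hom !(cmpl _ _ _ _ _ (fX _) (fX _)).
- by rewrite /codom map_inj_uniq ?enum_uniq.
- apply/hasPn=> x /flattenP[c /mapP[g gs ->] /codomP[i ->]].
  by have [q] := vs g i gs; rewrite !inE => /andP[].
Qed.

Corollary packing_of_weighted_blowup (T Q K : finType) (e : rel T) (eQ : rel Q)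
    (X : Q -> {set T}) (h : K -> {ffun 'I_6 -> Q}) (m : K -> nat) :
  (forall q q' x, x \in X q -> x \in X q' -> q = q') ->
  (forall q q' x y, eQ q q' -> x \in X q -> y \in X q' -> e x y) ->
  (forall k, 0 < m k -> H_hom eQ (h k)) ->
  (forall q, \sum_k m k * usage (h k) q <= #|X q|) ->
  exists s, [/\ H_packing e s, size s = \sum_k m k &
    forall f i, f \in s -> exists q, (f : {ffun _ -> _}) i \in X q].
Proof.
move=> disj cmpl hom hX.
pose hs := flatten [seq nseq (m k) (h k) | k <- enum K].
have [||s [ps ss vs]] := @packing_of_blowup T Q e eQ X hs disj cmpl.
- by move=> g /flattenP[c /mapP[k _ ->]]; rewrite mem_nseq => /andP[mk /eqP ->]; apply: hom.
- move=> q; apply: leq_trans (hX q).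
  rewrite big_flatten big_map -big_enum /=; apply: leq_sum => k _.
  by rewrite big_nseq iter_addn_0 mulnC.
exists s; split=> //; rewrite ss size_flatten /shape -map_comp sumnE big_map big_enum /=.
by apply: eq_bigr => k _; rewrite size_nseq.
Qed.

(** * Packing the blow-up of a dense pattern *)

Section Pattern.
Variables (P : rel 'I_6) (B B' : {set 'I_6}) (th th' : nat) (F : 'I_6 -> 'I_6 -> nat).

(** The classes of the blow-up: [Some (inl x)] and [Some (inr y)] collect the copies
    of the vertex [x], respectively [y], in the tiles of the two kinds, and [None] is
    the set of uncovered vertices. *)
Definition slot := option ('I_6 + 'I_6).

Definition slot_adj : rel slot := fun q q' =>
  match q, q' with
  | Some (inl x), Some (inr y) | Some (inr y), Some (inl x) => P x y
  | Some (inl x), None | None, Some (inl x) => x \in B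
  | Some (inr y), None | None, Some (inr y) => y \in B'
  | _, _ => false
  end.

(** One colour class of the proper 2-colouring of [H]. *)
Definition left_side : {set 'I_6} := [set vu; vc; vd].

(** [H] inside the [K_{3,3}] between two adjacent classes. *)
Definition edge_copy (q q' : slot) : {ffun 'I_6 -> slot} :=
  [ffun i => if i \in left_side then q else q'].

(** [H] around an edge between [B] and [B']: only two vertices of the tiles are consumed. *)
Definition centre_copy (q q' : slot) : {ffun 'I_6 -> slot} :=
  [ffun i => if i == vu then q else if i == vv then q' else None].

(** Index set of the new copies: edges of the pattern, and attached vertices of either
    tile that are joined to the uncovered set. *)
Definition plan := (('I_6 * 'I_6) + ('I_6 + 'I_6))%type.

Definition plan_copy (k : plan) : {ffun 'I_6 -> slot} :=
  match k with
  | inl (x, y) => (if x \in B then centre_copy else edge_copy) (Some (inl x)) (Some (inr y))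
  | inr (inl x) => edge_copy (Some (inl x)) None
  | inr (inr y) => edge_copy (Some (inr y)) None
  end.

(** A unit of the matching on an edge between [B] and [B'] stands for three vertices on
    either side, hence for three central edges, where the six vertices alone would
    have given two copies.  What the matching leaves of [B] and [B'] is joined to the
    uncovered set. *)
Definition plan_mult (k : plan) : nat :=
  match k with
  | inl (x, y) => if x \in B then 3 * F x y else F x y
  | inr (inl x) => if x \in B then th - \sum_y F x y else 0
  | inr (inr y) => if y \in B' then th' - \sum_x F x y else 0
  end.

Hypothesis hF : is_bmatching (useful P B B') (fun=> th) (fun=> th') F.

Lemma edge_copy_hom q q' : slot_adj q q' -> H_hom slot_adj (edge_copy q q').
Proof.
move=> h; have h' : slot_adj q' q by move: h; case: q => [[x|x]|]; case: q' => [[y|y]|].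
by rewrite /H_hom !ffunE !inE /= h h'.
Qed.

Lemma plan_hom k : 0 < plan_mult k -> H_hom slot_adj (plan_copy k).
Proof.
case: hF => FE _ _; case: k => [[x y]|[x|y]] /=.
- case: (boolP (x \in B)) => xB; last by move/FE => /andP[pxy _]; apply: edge_copy_hom.
  rewrite muln_gt0 /= => /FE /andP[pxy]; rewrite xB => /eqP/esym yB.
  by rewrite /H_hom !ffunE /= pxy xB yB.
- by case: ifP => // xB _; apply: edge_copy_hom.
- by case: ifP => // yB _; apply: edge_copy_hom.
Qed.

Lemma usage_edge_copy q q' s :
  usage (edge_copy q q') s = 3 * (q == s) + 3 * (q' == s).
Proof.
rewrite /usage -sum_cardT !big_ord_recl big_ord0 !ffunE !inE /=; by do 2! case: (_ == s).
Qed.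

Lemma usage_centre_copy q q' s : s != None ->
  usage (centre_copy q q') s = (q == s) + (q' == s).
Proof.
move=> s0; rewrite /usage -sum_cardT !big_ord_recl big_ord0 !ffunE /=.
by rewrite ![None == s]eq_sym (negbTE s0) !addn0.
Qed.

Lemma usage_le6 (h : 'I_6 -> slot) s : usage h s <= 6.
Proof. by apply: leq_trans (max_card _) _; rewrite card_ord. Qed.

Lemma plan_sum (f : plan -> nat) : \sum_k f k =
  \sum_x \sum_y f (inl (x, y)) + (\sum_x f (inr (inl x)) + \sum_y f (inr (inr y))).
Proof.
by rewrite big_sumType big_sumType pair_bigA; congr (_ + _); apply: eq_bigr => -[].
Qed.

Lemma plan_size : \sum_k plan_mult k = th * #|B| + th' * #|B'| + \sum_x \sum_y F x y.
Proof.
case: hF => FE Fr Fc; rewrite plan_sum /=.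
have e1 : \sum_x (if x \in B then th - \sum_y F x y else 0)
        + \sum_x \sum_y (if x \in B then F x y else 0) = th * #|B|.
  rewrite -big_split /= mulnC -sum_nat_const [RHS]big_mkcond /=.
  apply: eq_bigr => x _; case: ifP => _; last by rewrite big1.
  by rewrite subnK.
have e2 : \sum_y (if y \in B' then th' - \sum_x F x y else 0)
        + \sum_x \sum_y (if x \in B then F x y else 0) = th' * #|B'|.
  rewrite exchange_big -big_split /= mulnC -sum_nat_const [RHS]big_mkcond /=.
  apply: eq_bigr => y _; rewrite [X in _ + X](eq_bigr (fun x => if y \in B' then F x y else 0)).
    by case: ifP => _; rewrite ?subnK // big1.
  move=> x _; have [->|Fxy] := posnP (F x y); first by do 2! case: ifP.
  by have /andP[_ /eqP ->] := FE _ _ Fxy.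
have e3 : \sum_x \sum_y (if x \in B then 3 * F x y else F x y) =
    \sum_x \sum_y F x y + (\sum_x \sum_y (if x \in B then F x y else 0)).*2.
  rewrite -addnn -!big_split /=; apply: eq_bigr => x _.
  by rewrite -!big_split /=; apply: eq_bigr => y _; case: ifP => _; lia.
have assemble a b c d : a + d.*2 + (b + c) = b + d + (c + d) + a by lia.
by rewrite -e1 -e2 e3; apply: assemble.
Qed.

Lemma slot_eqE :
  (forall x x', (Some (inl x) == Some (inl x') :> slot) = (x == x')) *
  (forall y y', (Some (inr y) == Some (inr y') :> slot) = (y == y')) *
  (forall x y, (Some (inl x) == Some (inr y) :> slot) = false) *
  (forall x y, (Some (inr y) == Some (inl x) :> slot) = false) *
  (forall z, (None == Some z :> slot) = false).
Proof. by []. Qed.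

Lemma plan_usage_left x : \sum_k plan_mult k * usage (plan_copy k) (Some (inl x)) <= 3 * th.
Proof.
case: hF => FE Fr Fc; rewrite plan_sum /=.
rewrite [X in _ + (_ + X)]big1 => [|y _]; last first.
  by rewrite usage_edge_copy !slot_eqE muln0.
rewrite addn0 (bigD1 x) //= [X in _ + X + _]big1 => [|x' /negbTE nx]; last first.
  apply: big1 => y _; case: ifP => _; rewrite ?usage_edge_copy ?usage_centre_copy //;
  by rewrite !slot_eqE nx muln0.
rewrite [X in _ + X](bigD1 x) //= [X in _ + (_ + X)]big1 => [|x' /negbTE nx]; last first.
  by rewrite usage_edge_copy !slot_eqE nx muln0.
rewrite !addn0 usage_edge_copy !slot_eqE eqxx.
have -> : \sum_y (if x \in B then 3 * F x y else F x y) *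
   usage ((if x \in B then centre_copy else edge_copy) (Some (inl x)) (Some (inr y)))
     (Some (inl x)) = 3 * \sum_y F x y.
  rewrite big_distrr; apply: eq_bigr => y _.
  by case: ifP => _; rewrite ?usage_edge_copy ?usage_centre_copy // !slot_eqE eqxx;
    rewrite /= ?muln1 // mulnC.
by have := Fr x; set r := \sum_y _; case: ifP => _ /=; lia.
Qed.

Lemma plan_usage_right y : \sum_k plan_mult k * usage (plan_copy k) (Some (inr y)) <= 3 * th'.
Proof.
case: hF => FE Fr Fc; rewrite plan_sum /= exchange_big /=.
rewrite [X in _ + (X + _)]big1 => [|x _]; last first.
  by rewrite usage_edge_copy !slot_eqE muln0.
rewrite add0n (bigD1 y) //= [X in _ + X + _]big1 => [|y' /negbTE ny]; last first.
  apply: big1 => x _; case: ifP => _; rewrite ?usage_edge_copy ?usage_centre_copy //;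
  by rewrite !slot_eqE ny muln0.
rewrite [X in _ + X](bigD1 y) //= [X in _ + (_ + X)]big1 => [|y' /negbTE ny]; last first.
  by rewrite usage_edge_copy !slot_eqE ny muln0.
rewrite !addn0 usage_edge_copy !slot_eqE eqxx.
have -> : \sum_x (if x \in B then 3 * F x y else F x y) *
   usage ((if x \in B then centre_copy else edge_copy) (Some (inl x)) (Some (inr y)))
     (Some (inr y)) = 3 * \sum_x F x y.
  rewrite big_distrr; apply: eq_bigr => x _.
  by case: ifP => _; rewrite ?usage_edge_copy ?usage_centre_copy // !slot_eqE eqxx;
    rewrite /= ?muln1 // mulnC.
by have := Fc y; set r := \sum_x _; case: ifP => _ /=; lia.
Qed.

End Pattern.

(** Each of the at most [72] new copies takes at most six vertices of the class of
    uncovered vertices, whence [432]. *)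
Theorem pattern_packing (T : finType) (e : rel T) (P : rel 'I_6) (B B' : {set 'I_6})
    (th th' : nat) F (X : slot -> {set T}) :
  is_bmatching (useful P B B') (fun=> th) (fun=> th') F -> th <= 4 -> th' <= 4 ->
  (forall q q' x, x \in X q -> x \in X q' -> q = q') ->
  (forall q q' x y, slot_adj P B B' q q' -> x \in X q -> y \in X q' -> e x y) ->
  (forall x, #|X (Some (inl x))| = 3 * th) -> (forall y, #|X (Some (inr y))| = 3 * th') ->
  432 <= #|X None| ->
  exists s, [/\ H_packing e s, size s = th * #|B| + th' * #|B'| + \sum_x \sum_y F x y &
    forall f i, f \in s -> exists q, (f : {ffun _ -> _}) i \in X q].
Proof.
move=> hF hth hth' disj cmpl cl cr cY.
have [||s] := packing_of_weighted_blowup (h := plan_copy B) (m := plan_mult B B' th th' F)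
  disj cmpl.
- by move=> k; apply: plan_hom.
- case=> [[x|y]|]; first by rewrite cl; apply: plan_usage_left hF _.
    by rewrite cr; apply: plan_usage_right hF _.
  apply: leq_trans cY.
  apply: (@leq_trans (\sum_k plan_mult B B' th th' F k * 6)).
    by apply: leq_sum => k _; rewrite leq_mul2l usage_le6 orbT.
  rewrite -big_distrl /= (plan_size hF).
  have : \sum_x \sum_y F x y <= 6 * 4.
    case: hF => _ Fr _; apply: (@leq_trans (\sum_(x < 6) 4)).
      by apply: leq_sum => x _; apply: leq_trans hth.
    by rewrite sum_nat_const card_ord.
  have cB (C : {set 'I_6}) : #|C| <= 6 by apply: leq_trans (max_card _) _; rewrite card_ord.
  have := leq_mul hth (cB B); have := leq_mul hth' (cB B'); lia.
by rewrite (plan_size hF); exists s.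
Qed.

(** * Exchanges in a maximum packing *)

(** The global uniqueness of all used vertices amounts to pairwise disjointness. *)
Lemma H_packingP (T : finType) (e : rel T) (s : seq {ffun 'I_6 -> T}) :
  H_packing e s <->
  [/\ uniq s, {in s, forall f : {ffun 'I_6 -> T}, H_hom e f /\ injective f} &
    {in s &, forall f g : {ffun 'I_6 -> T}, forall i j, f i = g j -> f = g}].
Proof.
rewrite /H_packing; elim: s => [|f s IH] /=; first by split.
have -> : (H_hom e f && all (fun g : {ffun 'I_6 -> T} => H_hom e g) s) &&
    uniq (codom f ++ flatten [seq codom g | g : {ffun 'I_6 -> T} <- s]) =
  [&& H_hom e f, injectiveb f,
     ~~ has (mem (codom f)) (flatten [seq codom g | g : {ffun 'I_6 -> T} <- s]) &
     all (fun g : {ffun 'I_6 -> T} => H_hom e g) s &&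
     uniq (flatten [seq codom g | g : {ffun 'I_6 -> T} <- s])].
  rewrite cat_uniq /injectiveb /dinjectiveb /=.
  by case: (H_hom e f); case: (all _ s); rewrite /= ?andbF.
split.
  case/and4P=> hf /injectiveP fi /hasPn nf /IH [us hs ds].
  have nfs g i j : g \in s -> f i = (g : {ffun _ -> _}) j -> False.
    move=> gs eij; suff /nf/negP : f i \in flatten [seq codom g | g : {ffun 'I_6 -> T} <- s].
      by apply; apply: codom_f.
    by rewrite eij; apply/flattenP; exists (codom g); [apply/mapP; exists g|apply: codom_f].
  split.
  - rewrite us andbT; apply/negP=> fs. exact: (nfs f ord0 ord0 fs erefl).
  - by move=> g; rewrite inE => /orP[/eqP ->|/hs].
  - move=> g h; rewrite !inE => /orP[/eqP ->|gs] /orP[/eqP ->|hs'] i j //.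
    + by move/(nfs _ _ _ hs').
    + by move/esym/(nfs _ _ _ gs).
    + exact: ds.
case=> /andP[fs us] hs ds; have [hf fi] := hs f (mem_head _ _).
apply/and4P; split=> //; first exact/injectiveP.
  apply/hasPn=> x /flattenP[c /mapP[g gs ->] /codomP[j ->]]; apply/negP=> /codomP[i].
  move/esym => eij; have efg : f = g.
    by apply: ds eij; rewrite inE ?eqxx ?gs ?orbT.
  by rewrite efg gs in fs.
apply/IH; split=> // [g gs|g h gs hs']; first by apply: hs; rewrite inE gs orbT.
by apply: ds; rewrite inE ?gs ?hs' orbT.
Qed.

Section MaximumPacking.
Variables (T : finType) (e : rel T) (k : nat) (t : 'I_k -> {ffun 'I_6 -> T}).
Hypothesis e_sym : symmetric e.
Hypothesis t_hom : forall i, H_hom e (t i).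
Hypothesis t_inj : forall i j a b, t i a = t j b -> i = j /\ a = b.
Hypothesis t_max : forall s, H_packing e s -> size s <= k.

Definition uncovered : {set T} := [set y | [forall i, forall a, t i a != y]].

Lemma uncoveredP y i a : y \in uncovered -> t i a <> y.
Proof. by rewrite inE => /forallP/(_ i)/forallP/(_ a)/eqP. Qed.

(** A packing that lives on [U] and the tiles indexed by [S] can replace these tiles. *)
Lemma replacement (S : {set 'I_k}) (s : seq {ffun 'I_6 -> T}) : H_packing e s ->
  (forall f i, f \in s -> (f : {ffun _ -> _}) i \in uncovered \/
     exists j a, j \in S /\ f i = t j a) ->
  size s <= #|S|.
Proof.
move=> /H_packingP [us hs ds] hin.
pose r := [seq t i | i <- enum (~: S)].
have tI : injective t by move=> i j eij; have [] := @t_inj i j ord0 ord0; rewrite ?eij.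
have rP f : f \in r -> exists2 i, i \notin S & f = t i.
  by case/mapP=> i; rewrite mem_enum inE => iS ->; exists i.
have sep f g i j : f \in s -> g \in r -> (f : {ffun _ -> _}) i = (g : {ffun _ -> _}) j -> False.
  move=> fs /rP[l lS ->] eq; case: (hin f i fs) => [fu|[l' [a [l'S fa]]]].
    exact: uncoveredP fu (esym eq).
  by have [ell _] := t_inj (etrans (esym eq) fa); rewrite ell l'S in lS.
have /t_max : H_packing e (s ++ r).
  apply/H_packingP; split.
  - rewrite cat_uniq us map_inj_uniq ?enum_uniq // andbT; apply/hasPn=> f fr.
    by apply/negP=> fs; apply: (sep f f ord0 ord0).
  - move=> f; rewrite mem_cat => /orP[/hs //|/rP[i _ ->]]; split=> //.
    by move=> a b /t_inj[].
  - move=> f g; rewrite !mem_cat => /orP[fs|fr] /orP[gs|gr] i j.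
    + exact: ds.
    + by move/(sep _ _ _ _ fs gr).
    + by move/esym/(sep _ _ _ _ gs fr).
    + have [a _ ->] := rP _ fr; have [b _ ->] := rP _ gr.
      by case/t_inj => ->.
by rewrite size_cat size_map -cardE -[k in _ <= k]card_ord -(cardsC S) leq_add2r.
Qed.

Definition cross (i j : 'I_k) : rel 'I_6 := fun a b => e (t i a) (t j b).
Definition attached (i : 'I_k) (y : T) : {set 'I_6} := [set a | e (t i a) y].

(** In a maximum packing no dense pattern repeats over all pairs from two sets of
    twelve tiles and a set of [432] uncovered vertices; twelve is three times the
    largest capacity. *)
Lemma no_dense_blowup (P : rel 'I_6) (B B' : {set 'I_6}) (S N : {set 'I_k}) (Y : {set T}) :
  dense_pattern P B B' -> [disjoint S & N] -> Y \subset uncovered ->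
  12 <= #|S| -> 12 <= #|N| -> 432 <= #|Y| ->
  (forall i j y, i \in S -> j \in N -> y \in Y ->
     [/\ forall a b, P a b = cross i j a b, attached i y = B & attached j y = B']) ->
  False.
Proof.
move=> /dense_pattern_bmatching [th [th' [F [hth hth' hF big]]]] dSN YU cS cN cY hP.
have [|S0 sS0 cS0] := @subset_of_card _ S (3 * th); first by apply: leq_trans cS; lia.
have [|N0 sN0 cN0] := @subset_of_card _ N (3 * th'); first by apply: leq_trans cN; lia.
have dSN0 : S0 :&: N0 = set0.
  apply/eqP; rewrite -subset0; move: dSN; rewrite -setI_eq0 => /eqP <-; exact: setISS.
have [y0 y0Y] : exists y, y \in Y by apply/card_gt0P; apply: leq_trans cY.
have [i0 i0S] : exists i, i \in S by apply/card_gt0P; apply: leq_trans cS.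
have [j0 j0N] : exists j, j \in N by apply/card_gt0P; apply: leq_trans cN.
pose X (q : slot) : {set T} := match q with
  | Some (inl a) => [set t i a | i in S0]
  | Some (inr b) => [set t j b | j in N0]
  | None => Y end.
have sep i j : i \in S0 -> j \in N0 -> i <> j.
  by move=> iS jN ij; have : i \in S0 :&: N0 by [rewrite inE iS ij]; rewrite dSN0 inE.
have tY i a : t i a \in Y -> False by move/(subsetP YU) => h; exact: uncoveredP h erefl.
have [||||s [ps ss vs]] := pattern_packing (e := e) (X := X) hF hth hth' _ _ _ _ cY.
- move=> [[a|b]|] [[a'|b']|] x //=.
  + by move=> /imsetP[i iS ->] /imsetP[j jS /t_inj[_ ->]].
  + by move=> /imsetP[i iS ->] /imsetP[j jS /t_inj[/(sep _ _ iS jS)]].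
  + by move=> /imsetP[i iS ->] /tY.
  + by move=> /imsetP[i iS ->] /imsetP[j jS /t_inj[/esym/(sep _ _ jS iS)]].
  + by move=> /imsetP[i iS ->] /imsetP[j jS /t_inj[_ ->]].
  + by move=> /imsetP[i iS ->] /tY.
  + by move=> h /imsetP[i iS ex]; move: h; rewrite ex => /tY.
  + by move=> h /imsetP[i iS ex]; move: h; rewrite ex => /tY.
- have sS := subsetP sS0; have sN := subsetP sN0.
  move=> [[a|b]|] [[a'|b']|] x y //=.
  + move=> Pab /imsetP[i /sS iS ->] /imsetP[j /sN jN ->].
    by have [h _ _] := hP _ _ _ iS jN y0Y; rewrite h in Pab.
  + move=> aB /imsetP[i /sS iS ->] yY.
    by have [_ h _] := hP _ _ _ iS j0N yY; move: aB; rewrite -h inE.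
  + move=> Pab /imsetP[j /sN jN ->] /imsetP[i /sS iS ->].
    by have [h _ _] := hP _ _ _ iS jN y0Y; rewrite e_sym; rewrite h in Pab.
  + move=> aB /imsetP[j /sN jN ->] yY.
    by have [_ _ h] := hP _ _ _ i0S jN yY; move: aB; rewrite -h inE.
  + move=> aB yY /imsetP[i /sS iS ->].
    by have [_ h _] := hP _ _ _ iS j0N yY; move: aB; rewrite -h inE e_sym.
  + move=> aB yY /imsetP[j /sN jN ->].
    by have [_ _ h] := hP _ _ _ i0S jN yY; move: aB; rewrite -h inE e_sym.
- by move=> a; rewrite card_imset // => i j /t_inj[].
- by move=> b; rewrite card_imset // => i j /t_inj[].
have : size s <= #|S0 :|: N0|.
  apply: replacement ps _ => f i fs; have [[[a|b]|]] := vs f i fs.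
  - by case/imsetP=> j jS ->; right; exists j, a; rewrite inE jS.
  - by case/imsetP=> j jS ->; right; exists j, b; rewrite inE jS orbT.
  - by move/(subsetP YU); left.
have := cardsUI S0 N0; rewrite dSN0 cards0 addn0 => ->.
by rewrite leqNgt ss cS0 cN0 big.
Qed.

End MaximumPacking.

(** * Few dense triples *)

Lemma popular_value (X Y : finType) (E : pred X) (c : X -> Y) (y0 : Y) :
  exists y, \sum_x (E x : nat) <= #|Y| * \sum_x (E x && (c x == y) : nat).
Proof.
pose f y := \sum_x (E x && (c x == y) : nat).
have [|y my] := bigop.eq_bigmax f; first by apply/card_gt0P; exists y0.
exists y; rewrite -/(f y) -my -sum_nat_const.
have -> : \sum_x (E x : nat) = \sum_y f y.
  rewrite exchange_big; apply: eq_bigr => x _.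
  by under eq_bigr => y' _ do rewrite eq_sym; rewrite sum_andl.
by apply: leq_sum => y' _; apply: leq_bigmax.
Qed.

Section FewDenseTriples.
Variables (T : finType) (e : rel T) (k : nat) (t : 'I_k -> {ffun 'I_6 -> T}).
Hypothesis e_sym : symmetric e.
Hypothesis t_hom : forall i, H_hom e (t i).
Hypothesis t_inj : forall i j a b, t i a = t j b -> i = j /\ a = b.
Hypothesis t_max : forall s, H_packing e s -> size s <= k.

(** The tiles are disjoint, so their number is at most linear; the densities below can
    be measured against powers of the number of vertices. *)
Lemma tiles_le : 6 * k <= #|T|.
Proof.
have inj : injective (fun p : 'I_k * 'I_6 => t p.1 p.2).
  by move=> [i a] [j b] /= /t_inj[-> ->].
by have := leq_card _ inj; rewrite card_prod !card_ord mulnC.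
Qed.

Definition dense_triple (y : T) (p : 'I_k * 'I_k) :=
  [&& y \in uncovered t, p.1 != p.2 &
    dense_pattern (cross e t p.1 p.2) (attached e t p.1 y) (attached e t p.2 y)].

Definition pattern := ({set 'I_6 * 'I_6} * {set 'I_6} * {set 'I_6})%type.

Definition pattern_of (x : T * ('I_k * 'I_k)) : pattern :=
  ([set p | cross e t x.2.1 x.2.2 p.1 p.2], attached e t x.2.1 x.1, attached e t x.2.2 x.1).

Definition triple_threshold D :=
  let D1 := D * #|{: pattern}| in let D2 := kst_const 432 D1 in
  (2 * D1 * (2 * D1 * 432) + 2 * D2 * (2 * D2 * 12) + 12 * kst_const 12 D2).+1.

(** Otherwise one pattern is shown by a positive fraction of all triples.  A first
    extraction of common neighbours fixes [432] uncovered vertices and leaves a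
    positive fraction of the pairs of tiles, a second one finds twelve tiles that
    share twelve partners among these pairs. *)
Theorem few_dense_triples D : 0 < D -> triple_threshold D <= #|T| ->
  D * \sum_y \sum_p dense_triple y p < #|T| ^ 3.
Proof.
rewrite /triple_threshold; set n := #|T|; set D1 := D * _; set D2 := kst_const 432 D1.
move=> D0 hn; rewrite ltnNge; apply/negP => many.
have D10 : 0 < D1.
  rewrite muln_gt0 D0; apply/card_gt0P; by exists (set0, set0, set0).
have D20 : 0 < D2 by apply: kst_const_gt0.
have kn : k <= n by have := tiles_le; rewrite -/n; lia.
have [pi hpi] := popular_value (fun x => dense_triple x.1 x.2) pattern_of (set0, set0, set0).
pose R y p := dense_triple y p && (pattern_of (y, p) == pi).
have [|||||||Y cY hY] := @dense_common_neighbours T _ R 432 D1 n (n ^ 2) => //.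
- by rewrite card_prod card_ord -mulnn leq_mul.
- by rewrite expn_gt0; lia.
- lia.
- rewrite -expnS -mulnA; apply: leq_trans many _; rewrite leq_mul2l; apply/orP; right.
  by rewrite !pair_bigA.
pose R' i j := [forall y in Y, R y (i, j)].
have [|||||||S cS hS] := @dense_common_neighbours _ _ R' 12 D2 n n => //; rewrite ?card_ord //.
- lia.
- lia.
- rewrite mulnn; apply: leq_trans hY _; rewrite leq_mul2l; apply/orP; right.
  by rewrite pair_bigA /= -sum_cardT; apply: eq_leq; apply: eq_bigr => -[].
set N := [set _ | _] in hS.
have cN : 12 <= #|N|.
  have : 0 < kst_const 12 D2 by apply: kst_const_gt0.
  move: hS hn; set c := kst_const 12 D2; set m := #|N| => h1 h2 c0.
  have : c * 12 < c * m by lia.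
  by rewrite ltn_mul2l => /andP[_ /ltnW].
have [y0 y0Y] : exists y, y \in Y by apply/card_gt0P; rewrite cY.
have [i0 i0S] : exists i, i \in S by apply/card_gt0P; rewrite cS.
have [j0 j0N] : exists j, j \in N by apply/card_gt0P; apply: leq_trans cN.
have RP i j y : i \in S -> j \in N -> y \in Y -> R y (i, j).
  by move=> iS; rewrite inE => /forall_inP/(_ i iS)/forall_inP; apply.
have /andP[/and3P[_ _ dns] /eqP pi0] := RP _ _ _ i0S j0N y0Y.
apply: (@no_dense_blowup _ _ _ _ e_sym t_hom t_inj t_max (cross e t i0 j0)
  (attached e t i0 y0) (attached e t j0 y0) S N Y dns); rewrite ?cS ?cY //.
- rewrite -setI_eq0; apply/eqP/setP=> i; rewrite in_setI in_set0; apply/negP => /andP[iS iN].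
  by have /andP[/and3P[_ /eqP]] := RP _ _ _ iS iN y0Y.
- by apply/subsetP=> y yY; have /andP[/and3P[]] := RP _ _ _ i0S j0N yY.
move=> i j y iS jN yY; have /andP[_ /eqP] := RP _ _ _ iS jN yY.
rewrite -pi0 => -[/setP eP -> ->]; split=> // a b.
by have := eP (a, b); rewrite !inE.
Qed.

Definition uncovered_threshold D :=
  (2 * D * (2 * D * 3) + 6 * kst_const 3 D).+1.

(** A dense graph on [U] contains [K_{3,3}], hence a copy of [H] disjoint from all
    tiles. *)
Theorem uncovered_sparse D : 0 < D -> uncovered_threshold D <= #|T| ->
  D * \sum_(x in uncovered t) \sum_(y in uncovered t) e x y < #|T| ^ 2.
Proof.
rewrite /uncovered_threshold; set n := #|T| => D0 hn; rewrite ltnNge; apply/negP => many.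
pose R x y := [&& x \in uncovered t, y \in uncovered t & e x y].
have [|||||||S cS hS] := @dense_common_neighbours _ _ R 3 D n n => //.
- lia.
- lia.
- rewrite mulnn; apply: leq_trans many _; rewrite leq_mul2l; apply/orP; right.
  rewrite big_mkcond; apply: leq_sum => x _; case: (boolP (x \in _)) => // xU.
  by rewrite big_mkcond; apply: leq_sum => y _; rewrite /R xU; case: (y \in _).
set N := [set _ | _] in hS.
have cN : 6 <= #|N|.
  have : 0 < kst_const 3 D by apply: kst_const_gt0.
  move: hS hn; set c := kst_const 3 D; set m := #|N| => h1 h2 c0.
  have : c * 6 < c * m by lia.
  by rewrite ltn_mul2l => /andP[_ /ltnW].
have cN' : 3 <= #|N :\: S|.
  have := cardsID S N; have := subset_leq_card (subsetIr N S); rewrite cS; lia.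
have RP x y : x \in S -> y \in N -> R x y.
  by move=> xS; rewrite inE => /forall_inP/(_ x xS).
pose X (b : bool) := if b then S else N :\: S.
have [||||s [ps ss vs]] := @packing_of_blowup T bool e (fun b b' => b != b') X
   [:: [ffun i => i \in left_side]].
- move=> [] [] x //=; first by rewrite inE => -> /andP[].
  by rewrite inE => /andP[/negbTE ->].
- move=> [] [] x y //= _; rewrite inE.
    by move=> xS /andP[_ yN]; have /and3P[] := RP _ _ xS yN.
  by move=> /andP[_ xN] yS; have /and3P[_ _] := RP _ _ yS xN; rewrite e_sym.
- by move=> h; rewrite inE => /eqP ->; rewrite /H_hom !ffunE !inE.
- move=> b; rewrite big_seq1 /usage -sum_cardT !big_ord_recl big_ord0 !ffunE !inE /=.
  by case: b; rewrite /= ?cS.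
have : size s <= #|@set0 'I_k|.
  apply: (replacement t_hom t_inj t_max ps) => f i fs; left; have [[]] := vs f i fs.
    have [j0 j0N] : exists j, j \in N by apply/card_gt0P; apply: leq_trans cN.
    by move=> xS; have /and3P[] := RP _ _ xS j0N.
  have [i0 i0S] : exists i, i \in S by apply/card_gt0P; rewrite cS.
  by rewrite inE => /andP[_ yN]; have /and3P[] := RP _ _ i0S yN.
by rewrite ss cards0.
Qed.

End FewDenseTriples.

(** * Counting edges by triples *)

Section Counting.
Variables (T : finType) (e : rel T) (k : nat) (t : 'I_k -> {ffun 'I_6 -> T}).
Hypothesis e_sym : symmetric e.
Hypothesis t_inj : forall i j a b, t i a = t j b -> i = j /\ a = b.

Local Notation U := (uncovered t).

Lemma sum_over_tiles (f : T -> nat) :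
  \sum_x f x = \sum_i \sum_a f (t i a) + \sum_(y in U) f y.
Proof.
rewrite (bigID (mem U)) /= addnC; congr (_ + _).
rewrite pair_bigA /=.
rewrite -(big_imset f (h := fun p : 'I_k * 'I_6 => t p.1 p.2) (A := predT)) /=; last first.
  by move=> [i a] [j b] _ _ /= /t_inj[-> ->].
apply: eq_bigl => x; apply/idP/imsetP.
  rewrite inE negb_forall => /existsP[i]; rewrite negb_forall => /existsP[a].
  by rewrite negbK => /eqP <-; exists (i, a).
by case=> -[i a] _ ->; apply/negP=> /uncoveredP; apply.
Qed.

Lemma card_uncovered : 6 * k + #|U| = #|T|.
Proof.
have := sum_over_tiles (fun=> 1); rewrite !sum_nat_const !muln1 => ->.
by rewrite !card_ord mulnC.
Qed.

Definition tile_edges i j := \sum_a \sum_b cross e t i j a b.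
(** Counts ordered pairs of adjacent covered vertices, including those inside a tile. *)
Definition inner_edges := \sum_i \sum_j tile_edges i j.
Definition outer_edges := \sum_i \sum_(y in U) #|attached e t i y|.
Definition uncovered_edges := \sum_(x in U) \sum_(y in U) e x y.

Lemma edges_split : \sum_x \sum_y e x y = inner_edges + 2 * outer_edges + uncovered_edges.
Proof.
rewrite sum_over_tiles.
have e1 : \sum_i \sum_a \sum_y e (t i a) y = inner_edges + outer_edges.
  rewrite -big_split /=; apply: eq_bigr => i _.
  under eq_bigr do rewrite sum_over_tiles.
  rewrite big_split /= exchange_big /=; congr (_ + _).
  by rewrite exchange_big /=; apply: eq_bigr => y _; rewrite sum_cardT.
have e2 : \sum_(y in U) \sum_x e y x = outer_edges + uncovered_edges.
  under eq_bigr do rewrite sum_over_tiles.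
  rewrite big_split /= exchange_big /=; congr (_ + _).
  apply: eq_bigr => i _; apply: eq_bigr => y _; rewrite -sum_cardT.
  by apply: eq_bigr => a _; rewrite e_sym.
by rewrite e1 e2 mul2n -addnn !addnA.
Qed.

(** Bounds the number of triples for which the local inequality may fail: the dense
    ones and those with two equal tiles. *)
Definition exceptional :=
  \sum_y \sum_p dense_triple e t y p + k * #|U|.

Lemma sum_exceptional c : \sum_(y in U) \sum_i \sum_j
   (c * (dense_triple e t y (i, j) + (i == j))) <= c * exceptional.
Proof.
rewrite /exceptional.
apply: (@leq_trans (\sum_(y in U) c * (\sum_p dense_triple e t y p + k))).
  apply: leq_sum => y _.
  under eq_bigr do rewrite -big_distrr /=.
  rewrite -big_distrr /= leq_mul2l; apply/orP; right.
  under eq_bigr do rewrite big_split /=.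
  rewrite big_split /= pair_bigA leq_add //=.
  apply: eq_leq; rewrite (eq_bigr (fun=> 1)) ?sum_nat_const ?card_ord ?muln1 // => i _.
  by under eq_bigr do rewrite eq_sym; rewrite sum_eq1.
rewrite -big_distrr /= leq_mul2l; apply/orP; right.
rewrite big_split /= sum_nat_const mulnC leq_add2r.
by rewrite [leqRHS](bigID (mem U)) /= leq_addr.
Qed.

Lemma card6 (B : {set 'I_6}) : #|B| <= 6.
Proof. by apply: leq_trans (max_card _) _; rewrite card_ord. Qed.

Lemma tile_edges_le i j : tile_edges i j <= 36.
Proof.
apply: (@leq_trans (\sum_(a < 6) 6)); last by rewrite sum_nat_const card_ord.
by apply: leq_sum => a _; rewrite sum_cardT card6.
Qed.

(** Always the left-hand sides are at most [72] and [6], so exceptional triples exceed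
    the bounds [36] and [3] of the local inequality by at most [36] and [3]. *)
Lemma triple_bound y i j : y \in U ->
  tile_edges i j + 3 * #|attached e t i y| + 3 * #|attached e t j y| <=
    36 + 36 * (dense_triple e t y (i, j) + (i == j)) /\
  #|attached e t i y| <= 3 + 3 * (dense_triple e t y (i, j) + (i == j)).
Proof.
move=> yU; have := tile_edges_le i j; have := card6 (attached e t i y).
have := card6 (attached e t j y); rewrite /dense_triple yU /=.
case: (eqVneq i j) => [_|_] /=; first by split; lia.
case: (boolP (dense_pattern _ _ _)) => [_|]; first by split; lia.
rewrite /dense_pattern -/(tile_edges i j) => /norP[b1 /norP[b2 b3]].
by move: b1 b2 b3; rewrite -!leqNgt => b1 _ b3 _ _ _; split; [exact: b3|exact: b1].
Qed.

Lemma outer_double : \sum_(y in U) \sum_i \sum_(j < k) #|attached e t i y| = k * outer_edges.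
Proof.
under eq_bigr do under eq_bigr do rewrite sum_nat_const card_ord.
by rewrite exchange_big /= /outer_edges big_distrr /=;
  apply: eq_bigr => i _; rewrite big_distrr.
Qed.

Lemma outer_bound : k * outer_edges <= 3 * k ^ 2 * #|U| + 3 * exceptional.
Proof.
rewrite -outer_double; apply: leq_trans (leq_add (leqnn _) (sum_exceptional 3)).
have -> : 3 * k ^ 2 * #|U| = \sum_(y in U) \sum_(i < k) \sum_(j < k) 3.
  by rewrite !sum_nat_const !card_ord; lia.
rewrite -big_split /=; apply: leq_sum => y yU; rewrite -big_split /=.
apply: leq_sum => i _; rewrite -big_split /=; apply: leq_sum => j _.
by have [_] := triple_bound i j yU.
Qed.

Lemma inner_bound : inner_edges * #|U| + 6 * k * outer_edges <=
  36 * k ^ 2 * #|U| + 36 * exceptional.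
Proof.
apply: leq_trans (leq_add (leqnn _) (sum_exceptional 36)).
have -> : 36 * k ^ 2 * #|U| = \sum_(y in U) \sum_(i < k) \sum_(j < k) 36.
  by rewrite !sum_nat_const !card_ord; lia.
have -> : inner_edges * #|U| + 6 * k * outer_edges =
   \sum_(y in U) \sum_i \sum_j (tile_edges i j +
      3 * #|attached e t i y| + 3 * #|attached e t j y|).
  have split3 (f g : T -> 'I_k -> 'I_k -> nat) :
    \sum_(y in U) \sum_i \sum_j (f y i j + g y i j) =
    \sum_(y in U) \sum_i \sum_j f y i j + \sum_(y in U) \sum_i \sum_j g y i j.
    rewrite -big_split; apply: eq_bigr => y _.
    by rewrite -big_split; apply: eq_bigr => i _; rewrite -big_split.
  have distr3 (f : T -> 'I_k -> 'I_k -> nat) c :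
    \sum_(y in U) \sum_i \sum_j c * f y i j = c * \sum_(y in U) \sum_i \sum_j f y i j.
    rewrite big_distrr; apply: eq_bigr => y _.
    by rewrite big_distrr; apply: eq_bigr => i _; rewrite big_distrr.
  pose a y i (j : 'I_k) := #|attached e t i y|; pose b y (i : 'I_k) j := #|attached e t j y|.
  rewrite (split3 (fun y i j => tile_edges i j + 3 * a y i j) (fun y i j => 3 * b y i j)).
  rewrite (split3 (fun=> tile_edges) (fun y i j => 3 * a y i j)) (distr3 a) (distr3 b).
  (* The same [y] serves both tiles, so each attached pair is counted [k] times from
     either side. *)
  rewrite {}/a {}/b sum_nat_const outer_double.
  under [X in _ + 3 * X]eq_bigr do rewrite exchange_big /=.
  by rewrite outer_double -/inner_edges mulnC -!mulnA; lia.
rewrite -big_split /=; apply: leq_sum => y yU; rewrite -big_split /=.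
apply: leq_sum => i _; rewrite -big_split /=; apply: leq_sum => j _.
by have [] := triple_bound i j yU.
Qed.

Lemma inner_trivial : inner_edges <= 36 * k ^ 2.
Proof.
have -> : 36 * k ^ 2 = \sum_(i < k) \sum_(j < k) 36.
  by rewrite !sum_nat_const !card_ord; lia.
by apply: leq_sum => i _; apply: leq_sum => j _; apply: tile_edges_le.
Qed.

Lemma outer_trivial : outer_edges <= 6 * k * #|U|.
Proof.
have -> : 6 * k * #|U| = \sum_(i < k) \sum_(y in U) 6.
  by rewrite !sum_nat_const !card_ord; lia.
by apply: leq_sum => i _; apply: leq_sum => y _; apply: card6.
Qed.

End Counting.

(** * Tilings of a graph as packings *)

Section Graphs.
Variables (T : finType).

Definition adjacent (G : sgraph T) : rel T := fun x y => [set x; y] \in edges G.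

Lemma adjacent_sym G : symmetric (adjacent G).
Proof. by move=> x y; rewrite /adjacent setUC. Qed.

Lemma card_edge (G : sgraph T) E : E \in edges G -> #|E| = 2.
Proof. by move=> GE; have /forall_inP/(_ E GE)/eqP := edges_card2 G. Qed.

Lemma handshake (G : sgraph T) : \sum_x \sum_y adjacent G x y = 2 * #|edges G|.
Proof.
have -> : \sum_x \sum_y adjacent G x y =
    \sum_(E in edges G) \sum_x \sum_y ([set x; y] == E).
  rewrite [RHS]exchange_big /=; apply: eq_bigr => x _.
  rewrite [RHS]exchange_big /=; apply: eq_bigr => y _.
  rewrite /adjacent; case: (boolP (_ \in _)) => [GE|nE].
    rewrite (bigD1 _ GE) /= eqxx big1 // => E /andP[_].
    by rewrite eq_sym => /negbTE ->.
  by rewrite big1 // => E GE; case: eqP GE nE => // -> ->.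
rewrite mulnC -sum_nat_const; apply: eq_bigr => E /card_edge/eqP/cards2P[a [b [ab ->]]].
rewrite pair_bigA /= sum_cardT.
rewrite (_ : [set _ | _] = [set (a, b); (b, a)]).
  by rewrite cards2 xpair_eqE negb_and ab.
apply/setP=> -[x y]; rewrite !inE /= !xpair_eqE; apply/eqP/idP.
  move/setP=> h; move: (h x) (h y) (h a) (h b); rewrite !inE !eqxx ?orbT /=.
  move=> /esym/orP[] /eqP -> /esym/orP[] /eqP ->; rewrite ?eqxx ?orbT //=.
    by move=> _; rewrite orbb eq_sym (negbTE ab).
  by rewrite orbb (negbTE ab).
by case/orP=> /andP[/eqP -> /eqP ->] //; rewrite setUC.
Qed.

Definition copy_of (f : {ffun 'I_6 -> T}) : {set T} * {set {set T}} :=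
  (f @: [set: 'I_6], [set f @: (E : {set 'I_6}) | E in edges H]).

Lemma copy_of_subset (f : {ffun 'I_6 -> T}) G :
  ([set f @: (E : {set 'I_6}) | E in edges H] \subset edges G) = H_hom (adjacent G) f.
Proof.
have im a b : f @: [set a; b] = [set f a; f b] by rewrite imsetU1 imset_set1.
rewrite /H_hom /adjacent -!im; apply/subsetP/and5P.
  by move=> h; split; apply: h; apply: imset_f; rewrite !inE eqxx ?orbT.
case=> h1 h2 h3 h4 h5 E /imsetP[E' + ->].
by rewrite !inE -!orbA => /or4P[/eqP->|/eqP->|/eqP->|/orP[/eqP->|/eqP->]].
Qed.

Lemma packing_le_nu (G : sgraph T) s : H_packing (adjacent G) s -> size s <= nu H G.
Proof.
move=> /H_packingP[us hs ds].
have disj f g : f \in s -> g \in s -> ~~ [disjoint (copy_of f).1 & (copy_of g).1] -> f = g.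
  move=> fs gs /pred0Pn[x /andP[/imsetP[i _ ->] /imsetP[j _]]]; exact: ds.
have inj : {in s &, injective copy_of}.
  move=> f g fs gs efg; apply: disj => //; rewrite -efg; apply/pred0Pn.
  by exists (f ord0); rewrite /= andbb imset_f.
have -> : size s = #|[set:: map copy_of s]|.
  by rewrite cardsE (card_uniqP _) ?size_map // map_inj_in_uniq.
rewrite /nu (bigop.bigmax_sup [set:: map copy_of s]) //.
apply/andP; split.
  apply/forall_inP=> S; rewrite inE => /mapP[f fs ->]; have [hf fi] := hs f fs.
  apply/existsP; exists f; rewrite /= !eqxx copy_of_subset hf !andbT.
  exact/injectiveP.
apply/forall_inP=> S1; rewrite inE => /mapP[f fs ->].
apply/forall_inP=> S2; rewrite inE => /mapP[g gs ->].
by apply/implyP; apply: contraR => /(disj _ _ fs gs) ->.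
Qed.

Lemma nu_packing (G : sgraph T) : exists2 s, H_packing (adjacent G) s & size s = nu H G.
Proof.
have t0 : is_tiling H G set0 by apply/andP; split; apply/forall_inP=> S; rewrite inE.
have [|P hP eP] := @bigop.eq_bigmax_cond _ (is_tiling H G) (fun P => #|P|).
  by apply/card_gt0P; exists set0.
have -> : nu H G = #|P| by exact: eP.
have [/forall_inP cP /forall_inP dP] := andP hP.
have cS S : S \in P -> exists f : {ffun 'I_6 -> T},
    [/\ injective f, S = copy_of f & H_hom (adjacent G) f].
  move=> /cP /existsP[f /and4P[/injectiveP fi /eqP e1 /eqP e2 sub]].
  exists f; split=> //; first by rewrite [S]surjective_pairing e1 e2.
  by rewrite -copy_of_subset -e2.
have [P0|[S0 PS0]] := set_0Vmem P.
  by exists [::]; rewrite ?P0 ?cards0.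
have [f0 _] := cS _ PS0.
pose pk S := odflt f0 [pick f : {ffun 'I_6 -> T} |
   [&& injectiveb f, S == copy_of f & H_hom (adjacent G) f]].
have pkP S : S \in P ->
    [/\ injective (pk S), S = copy_of (pk S) & H_hom (adjacent G) (pk S)].
  move=> /cS [f [fi ef hf]]; rewrite /pk; case: pickP => [g /and3P[/injectiveP]|/(_ f)].
    by move=> gi /eqP eg hg; split.
  by rewrite -ef eqxx hf !andbT => /negbT/negP[]; apply/injectiveP.
exists (map pk (enum P)); last by rewrite size_map -cardE.
apply/H_packingP; split.
- rewrite map_inj_in_uniq ?enum_uniq // => S S'; rewrite !mem_enum => PS PS' e.
  by have [_ -> _] := pkP _ PS; have [_ -> _] := pkP _ PS'; rewrite e.
- by move=> f /mapP[S]; rewrite mem_enum => /pkP[fi _ hf] ->.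
move=> f g /mapP[S] + -> /mapP[S'] + -> i j; rewrite !mem_enum => PS PS' eij.
have [eS|neq] := eqVneq S S'; first by rewrite eS.
have inR R l : R \in P -> pk R l \in R.1.
  move=> /pkP[_ eR _]; suff : pk R l \in (copy_of (pk R)).1 by rewrite -eR.
  exact: imset_f.
have /forall_inP/(_ _ PS')/implyP/(_ neq)/pred0P/(_ (pk S i)) := dP _ PS.
by rewrite /= inR // eij inR.
Qed.

(** Indexing the tiles by ['I_(nu H G)] gives the form used for exchanges. *)
Lemma maximum_packing (G : sgraph T) : exists t : 'I_(nu H G) -> {ffun 'I_6 -> T},
  (forall i, H_hom (adjacent G) (t i)) /\
  (forall i j a b, t i a = t j b -> i = j /\ a = b).
Proof.
have [s /H_packingP[us hs ds] ss] := nu_packing G; rewrite -ss.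
case: s us hs ds {ss} => [|f s] us hs ds.
  have t0 : 'I_0 -> {ffun 'I_6 -> T} by case.
  by exists t0; split=> -[].
pose r := f :: s; exists (fun i : 'I_(size r) => nth f r i).
have rP (i : 'I_(size r)) : nth f r i \in r by apply: mem_nth.
split=> [i|i j a b eij]; first by have [] := hs _ (rP i).
have e := ds _ _ (rP i) (rP j) _ _ eij.
move: eij; rewrite -e; have [_ inj] := hs _ (rP i); move/inj => ->; split=> //.
by apply/val_inj/eqP; move/eqP: e; rewrite nth_uniq.
Qed.

Lemma packing_card (e : rel T) s (A : {set T}) c : H_packing e s ->
  (forall f : {ffun 'I_6 -> T}, injective f -> H_hom e f -> c <= #|[set i | f i \in A]|) ->
  c * size s <= #|A|.
Proof.
move=> ps hc; have [_ hs _] := (H_packingP e s).1 ps.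
case/andP: ps => _; set w := flatten _ => uw.
have : count (mem A) w <= #|A|.
  rewrite -size_filter -(card_uniqP _) ?filter_uniq //.
  by apply: subset_leq_card; apply/subsetP=> x; rewrite mem_filter => /andP[].
apply: leq_trans; rewrite /w {w uw}; elim: s hs => [|f s IH] hs; first by rewrite muln0.
rewrite /= count_cat mulnS leq_add //.
  have [hf fi] := hs f (mem_head _ _); apply: leq_trans (hc f fi hf) _.
  by rewrite codomE count_map -sum1_count big_enum_cond /= sum1dep_card.
by apply: IH => g gs; apply: hs; rewrite inE gs orbT.
Qed.

Definition graph_edges (r : rel T) : {set {set T}} :=
  [set E : {set T} | (#|E| == 2) && [forall x in E, forall y in E, (x != y) ==> r x y]].

Lemma graph_edges_card2 r : [forall E in graph_edges r, #|E| == 2].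
Proof. by apply/forall_inP=> E; rewrite inE => /andP[]. Qed.

Definition graph_of r : sgraph T := SGraph (graph_edges_card2 r).

Lemma adjacent_graph_of r x y : symmetric r -> adjacent (graph_of r) x y = (x != y) && r x y.
Proof.
move=> rs; rewrite /adjacent inE cards2 eqSS eqb1; case: eqVneq => //= nxy.
apply/forall_inP/idP => [/(_ x)|rxy a].
  by rewrite !inE eqxx => /(_ isT)/forall_inP/(_ y); rewrite !inE eqxx orbT nxy => /(_ isT).
rewrite !inE => /orP[] /eqP ->; apply/forall_inP=> b; rewrite !inE => /orP[] /eqP ->;
  by rewrite ?eqxx // ?rxy ?implybT // rs rxy implybT.
Qed.

End Graphs.

(** * Extremal graphs and the counting inequalities *)

Lemma vertex_cases (i : 'I_6) : i \in [:: vu; vv; va; vb; vc; vd].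
Proof. by case: i => -[|[|[|[|[|[|]]]]]]. Qed.

(** Each of the two colour classes of [H] has three vertices, and one of them is mapped
    into the part of size [3k]. *)
Lemma bipartite_extremal n k : 3 * k <= n ->
  exists2 G : sgraph 'I_n, nu H G <= k & #|edges G| = 3 * k * (n - 3 * k).
Proof.
move=> kn; have [|A _ cA] := @subset_of_card _ [set: 'I_n] (3 * k).
  by rewrite cardsT card_ord.
pose r : rel 'I_n := fun x y => (x \in A) (+) (y \in A).
have rs : symmetric r by move=> x y; rewrite /r addbC.
exists (graph_of r).
  have [s ps <-] := nu_packing (graph_of r).
  rewrite -(leq_pmul2l (m := 3)) // -cA; apply: packing_card ps _ => f fi.
  rewrite /H_hom !(adjacent_graph_of _ _ rs) => /and5P[].
  move=> /andP[_ uv] /andP[_ ua] /andP[_ ub] /andP[_ vc] /andP[_ vd].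
  move: uv ua ub vc vd; rewrite /r; case: (boolP (f vu \in A)) => uA; rewrite ?addTb ?addFb.
    move=> /negbTE -> _ _ /= cA' dA.
    apply: (@leq_trans #|[set vu; vc; vd]|); first by rewrite setUC cardsU1 cards2 !inE.
    by apply: subset_leq_card; apply/subsetP=> i; rewrite !inE => /orP[/orP[]|] /eqP ->.
  move=> vA aA bA _ _.
  apply: (@leq_trans #|[set vv; va; vb]|); first by rewrite setUC cardsU1 cards2 !inE.
  by apply: subset_leq_card; apply/subsetP=> i; rewrite !inE => /orP[/orP[]|] /eqP ->.
have cA' : #|~: A| = n - 3 * k by rewrite cardsCs setCK cA card_ord.
apply/eqP; rewrite -(eqn_pmul2l (m := 2)) // -handshake -cA' -cA.
have row x : \sum_y adjacent (graph_of r) x y = if x \in A then #|~: A| else #|A|.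
  rewrite sum_cardT; case: ifP => xA; apply: eq_card => y; rewrite !inE;
    rewrite (adjacent_graph_of _ _ rs) /r xA ?addTb ?addFb.
    by case: (eqVneq x y) => [<-|]//; rewrite xA.
  by case: (eqVneq x y) => [<-|]//; rewrite xA.
rewrite (eq_bigr _ (fun x _ => row x)) (bigID (mem A)) /=.
rewrite (eq_bigr (fun=> #|~: A|)) => [|x ->] //.
rewrite [X in _ + X](eq_bigr (fun=> #|A|)) => [|x /negbTE ->] //.
rewrite !sum_nat_const; apply/eqP.
have -> : #|[pred x | x \notin A]| = #|~: A| by apply: eq_card => x; rewrite !inE.
by rewrite mul2n -addnn [X in _ + X]mulnC.
Qed.

(** No vertex of [H] is isolated, so every copy lies inside the clique. *)
Lemma clique_extremal n k : 6 * k <= n ->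
  exists2 G : sgraph 'I_n, nu H G <= k & 2 * #|edges G| + 6 * k = 36 * k ^ 2.
Proof.
move=> kn; have [|A _ cA] := @subset_of_card _ [set: 'I_n] (6 * k).
  by rewrite cardsT card_ord.
pose r : rel 'I_n := fun x y => (x \in A) && (y \in A).
have rs : symmetric r by move=> x y; rewrite /r andbC.
exists (graph_of r).
  have [s ps <-] := nu_packing (graph_of r).
  rewrite -(leq_pmul2l (m := 6)) // -cA; apply: packing_card ps _ => f fi.
  rewrite /H_hom !(adjacent_graph_of _ _ rs) => /and5P[].
  move=> /and3P[_ uA vA] /and3P[_ _ aA] /and3P[_ _ bA] /and3P[_ _ cA'] /and3P[_ _ dA].
  have -> : [set i | f i \in A] = setT; last by rewrite cardsT card_ord.
  apply/setP=> i; rewrite !inE; have := vertex_cases i; rewrite !inE.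
  by do 5! (case/orP=> [/eqP->//|]); move/eqP=> ->.
rewrite -handshake.
have row x : x \in A -> \sum_y adjacent (graph_of r) x y + 1 = #|A|.
  move=> xA; rewrite sum_cardT (cardsD1 x A) xA addnC; congr (_ + _).
  apply: eq_card => y; rewrite !inE (adjacent_graph_of _ _ rs) /r xA.
  by rewrite eq_sym.
rewrite (bigID (mem A)) /= [X in _ + X + _]big1 => [|x xA]; last first.
  by rewrite big1 // => y _; rewrite (adjacent_graph_of _ _ rs) /r (negbTE xA) andbF.
rewrite addn0 -cA -[X in _ + X]muln1 -sum_nat_const -big_split /=.
rewrite (eq_bigr _ row) sum_nat_const cA; lia.
Qed.

Definition size_threshold D :=
  triple_threshold D + uncovered_threshold D + D.

(** All that the combinatorial part says about a graph [G]: [a], [b] and [c] count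
    adjacent ordered pairs of covered vertices, edges between covered and uncovered
    vertices, and adjacent ordered pairs of uncovered vertices; [E] bounds the number
    of exceptional triples. *)
Theorem extremal_inequalities n (G : sgraph 'I_n) D :
  0 < D -> size_threshold D <= n ->
  let k := nu H G in
  exists u a b c E, [/\ 6 * k + u = n, 2 * #|edges G| = a + 2 * b + c,
    [/\ a * u + 6 * k * b <= 36 * k ^ 2 * u + 36 * E, k * b <= 3 * k ^ 2 * u + 3 * E,
     a <= 36 * k ^ 2 & b <= 6 * k * u],
    D * c <= n ^ 2 & D * E <= 2 * n ^ 3].
Proof.
move=> D0 + k; rewrite /size_threshold => hn.
have [t [th ti]] := maximum_packing G.
have tm := @packing_le_nu _ G.
have es := @adjacent_sym _ G.
have cU := card_uncovered ti; rewrite card_ord -/k in cU.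
have bad := few_dense_triples es th ti tm D0; rewrite card_ord in bad.
have sparse := uncovered_sparse es th ti tm D0; rewrite card_ord in sparse.
exists #|uncovered t|, (inner_edges (adjacent G) t), (outer_edges (adjacent G) t),
  (uncovered_edges (adjacent G) t), (exceptional (adjacent G) t); split=> //.
- by rewrite -handshake; apply: edges_split.
- split; [exact: inner_bound|exact: outer_bound|exact: inner_trivial|exact: outer_trivial].
- by apply: ltnW; apply: sparse; lia.
rewrite /exceptional mulnDr mul2n -addnn; apply: leq_add.
  by apply: ltnW; apply: bad; lia.
have hk : k <= n by lia.
have hu : #|uncovered t| <= n by apply: leq_trans (leq_addl _ _) (eq_leq cU).
have hD : D <= n by lia.
by rewrite !expnS expn0 muln1; apply: leq_mul => //; apply: leq_mul.
Qed.

(** * Optimisation over the reals *)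

Section Optimisation.
Local Open Scope ring_scope.

(** When [u <= 3k] the coefficient [6k] of [b] is at least [2u], so the first inequality
    alone bounds [(a + 2b) u].  If [u] is tiny, then so is [b]. *)
Lemma optimise_dense (R : realFieldType) (n k u a b E g : R) :
  0 < n -> 0 < g -> 0 <= k -> 0 <= u -> 0 <= b -> 6 * k + u = n ->
  a * u + 6 * k * b <= 36 * k ^+ 2 * u + 36 * E ->
  a <= 36 * k ^+ 2 -> b <= 6 * k * u -> E <= 2 * g ^+ 2 * n ^+ 3 ->
  u <= 3 * k -> a + 2 * b <= 36 * k ^+ 2 + 72 * g * n ^+ 2.
Proof.
move=> n0 g0 k0 u0 b0 en hab ha hb hE hu.
have gn0 : 0 < g * n by rewrite mulr_gt0.
have [small|large] := ltP u (g * n).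
  have h1 : 6 * k * u <= n * (g * n).
    by apply: ler_pM => //; [nra| lra| lra].
  by rewrite -mulrA expr2; nra.
have up : 0 < u by lra.
have hE' : 36 * E <= 72 * g * n ^+ 2 * u.
  have : g * n ^+ 2 * (g * n) <= g * n ^+ 2 * u.
    by rewrite ler_wpM2l // mulr_ge0 ?exprn_ge0 // ltW.
  rewrite !expr2 !exprS expr0 in hE *; nra.
have h2 : 2 * b * u <= 6 * k * b by nra.
by rewrite -(ler_pM2r up) !mulrDl; lra.
Qed.

(** When [u >= 3k] the bound on [(a + 2b) k u] is the first inequality times [k] plus
    the second times [2u - 6k].  If [k] is tiny, all edges at the tiles are few. *)
Lemma optimise_sparse (R : realFieldType) (n k u a b E g : R) :
  0 < n -> 0 < g -> 0 <= k -> 0 <= u -> 0 <= b -> 6 * k + u = n ->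
  a * u + 6 * k * b <= 36 * k ^+ 2 * u + 36 * E ->
  k * b <= 3 * k ^+ 2 * u + 3 * E ->
  a <= 36 * k ^+ 2 -> b <= 6 * k * u -> 0 <= E <= 2 * g ^+ 2 * n ^+ 3 ->
  3 * k <= u -> a + 2 * b <= 6 * k * (n - 3 * k) + 72 * g * n ^+ 2.
Proof.
move=> n0 g0 k0 u0 b0 en hab hb' ha hb /andP[E0 hE] hu.
have gn0 : 0 < g * n by rewrite mulr_gt0.
have [small|large] := ltP k (g * n).
  have h1 : k * n <= g * n * n by rewrite ler_wpM2r //; lra.
  have h2 : k * k <= k * n by rewrite ler_wpM2l //; lra.
  have h3 : k * u <= k * n by rewrite ler_wpM2l //; lra.
  by rewrite !expr2 in ha *; nra.
have kp : 0 < k by lra.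
have up : 0 < u by lra.
have kup : 0 < k * u by rewrite mulr_gt0.
rewrite -(ler_pM2r kup).
have h1 : (a * u + 6 * k * b) * k <= (36 * k ^+ 2 * u + 36 * E) * k by rewrite ler_wpM2r.
have h2 : (2 * u - 6 * k) * (k * b) <= (2 * u - 6 * k) * (3 * k ^+ 2 * u + 3 * E).
  by rewrite ler_wpM2l //; lra.
have h3 : (18 * k + 6 * u) * E <= 6 * n * (2 * g ^+ 2 * n ^+ 3).
  by apply: ler_pM => //; lra.
have h4 : g * n * (n / 3) <= k * u by apply: ler_pM; lra.
have h5 : 72 * g * n ^+ 2 * (g * n * (n / 3)) <= 72 * g * n ^+ 2 * (k * u).
  by rewrite ler_wpM2l // !mulr_ge0 ?exprn_ge0 ?ltW // ltr0n.
have e1 : 72 * g * n ^+ 2 * (g * n * (n / 3)) = 2 * (6 * n * (2 * g ^+ 2 * n ^+ 3)) by field.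
have h6 : 0 <= 6 * n * (2 * g ^+ 2 * n ^+ 3).
  by rewrite !mulr_ge0 ?exprn_ge0 ?ltW // ltr0n.
have e2 : (a + 2 * b) * (k * u) =
  (a * u + 6 * k * b) * k + (2 * u - 6 * k) * (k * b) by ring.
have e3 : (6 * k * (n - 3 * k) + 72 * g * n ^+ 2) * (k * u) =
  (36 * k ^+ 2 * u + 36 * E) * k + (2 * u - 6 * k) * (3 * k ^+ 2 * u + 3 * E)
  - (18 * k + 6 * u) * E + 72 * g * n ^+ 2 * (k * u) by rewrite -en; ring.
by rewrite e2 e3; lra.
Qed.

Lemma Xi_ge_clique (R : realType) (beta n k : R) :
  0 < n -> 0 <= k -> k <= beta * n -> n <= 9 * k -> 18 * k ^+ 2 <= Xi beta * n ^+ 2.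
Proof.
move=> n0 k0 kb nk; rewrite /Xi; case: ifP => [h|_].
  have eb : beta = 1 / 9.
    apply/eqP; rewrite eq_le h /= -(ler_pM2r n0); lra.
  have -> : k = n / 9 by move: kb; rewrite eb; lra.
  suff -> : 18 * (n / 9) ^+ 2 = 3 * beta * (1 - 3 * beta) * n ^+ 2 by [].
  by rewrite eb; field.
rewrite -mulrA -exprMn ler_pM2l ?ltr0n // lerXn2r // nnegrE //; lra.
Qed.

(** The bound [3k(n - 3k)] increases with [k] up to [k = n/6]; for [beta > 1/9] it is
    at most [2 n^2 / 9], its common value with [18 k^2] at [k = n/9]. *)
Lemma Xi_ge_bipartite (R : realType) (beta n k : R) :
  0 < n -> 0 <= k -> k <= beta * n -> 9 * k <= n -> 3 * k * (n - 3 * k) <= Xi beta * n ^+ 2.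
Proof.
move=> n0 k0 kb nk; rewrite /Xi; case: ifP => [h|/negbT].
  have hb : beta * n <= n / 9 by rewrite -(ler_pM2r n0) in h; lra.
  have : 0 <= 3 * (beta * n - k) * (n - 3 * (beta * n + k)).
    by rewrite !mulr_ge0 //; lra.
  by rewrite expr2; lra.
rewrite -ltNge => h.
have hb : n / 9 <= beta * n by rewrite -(ltr_pM2r n0) in h; lra.
have h1 : 18 * (n / 9) ^+ 2 <= 18 * beta ^+ 2 * n ^+ 2.
  by rewrite -mulrA -exprMn ler_pM2l ?ltr0n // lerXn2r // nnegrE; lra.
apply: le_trans h1; rewrite expr2; nra.
Qed.

End Optimisation.

(** * The extremal function *)

Local Open Scope ring_scope.

Lemma Xi_ge0 (R : realType) (beta : R) : 0 <= beta -> 0 <= Xi beta.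
Proof.
move=> b0; rewrite /Xi; case: ifP => [h|_]; last by rewrite mulr_ge0 ?exprn_ge0 ?ler0n.
by rewrite !mulr_ge0 ?ler0n //; lra.
Qed.

Lemma ex_tiling_le (R : realType) n (x : R) (B : R) : 0 <= B ->
  (forall G : sgraph 'I_n, (nu H G)%:R < x -> #|edges G|%:R <= B) ->
  (ex_tiling H n x)%:R <= B.
Proof.
move=> B0 hB; rewrite /ex_tiling.
apply: (big_ind (fun m : nat => m%:R <= B)) => // m p hm hp.
by rewrite /maxn; case: ifP.
Qed.

(** The error [37 / m] comes from the exceptional triples and the uncovered edges,
    which are a fraction [1 / m^2] of all triples, respectively pairs. *)
Lemma ex_tiling_upper (R : realType) (beta : R) (m n : nat) : 0 <= beta ->
  (0 < m)%N -> (size_threshold (m ^ 2) <= n)%N ->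
  (ex_tiling H n (beta * n%:R))%:R <= (Xi beta + 37 / m%:R) * n%:R ^+ 2.
Proof.
move=> b0 m0 hn.
have n0 : (0 < n)%N by apply: leq_trans hn; rewrite /size_threshold /triple_threshold addSn.
have nR : 0 < n%:R :> R by rewrite ltr0n.
have g0 : 0 < m%:R^-1 :> R by rewrite invr_gt0 ltr0n.
have g1 : m%:R^-1 <= 1 :> R by rewrite invf_le1 ?ler1n ?ltr0n.
have Xi0 := Xi_ge0 b0.
have gn : 0 <= m%:R^-1 * n%:R ^+ 2 :> R by rewrite mulr_ge0 ?exprn_ge0 ?ler0n // ltW.
apply: ex_tiling_le => [|G hG].
  by rewrite mulr_ge0 ?exprn_ge0 ?ler0n // addr_ge0 // mulr_ge0 ?ler0n // ltW.
have m20 : (0 < m ^ 2)%N by rewrite expn_gt0 m0.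
have [u [a [b [c [E [en ee [i1 i2 i3 i4] i5 i6]]]]]] := extremal_inequalities G m20 hn.
move: hG en ee i1 i2 i3 i4 i5 i6; set k := nu H G => hG.
have toR x y : (x <= y)%N -> x%:R <= y%:R :> R by rewrite ler_nat.
move=> /(congr1 (fun x => x%:R : R)) en /(congr1 (fun x => x%:R : R)) ee.
move=> /toR i1 /toR i2 /toR i3 /toR i4 /toR i5 /toR i6.
rewrite !(natrD, natrM, natrX) in en ee i1 i2 i3 i4 i5 i6.
have mn : m%:R != 0 :> R by rewrite pnatr_eq0 -lt0n.
have hc : c%:R <= m%:R^-1 * n%:R ^+ 2 :> R.
  apply: (@le_trans _ _ (m%:R^-1 ^+ 2 * n%:R ^+ 2)).
    by rewrite exprVn ler_pdivlMl ?exprn_gt0 ?ltr0n.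
  by rewrite ler_wpM2r ?exprn_ge0 ?ler0n // expr2 ler_piMr // ltW //.
have hE : E%:R <= 2 * m%:R^-1 ^+ 2 * n%:R ^+ 3 :> R.
  by rewrite -mulrA mulrCA exprVn ler_pdivlMl ?exprn_gt0 ?ltr0n.
have [sparse|dense] := lerP (3 * k%:R) (u%:R : R).
  have := optimise_sparse nR g0 (ler0n _ _) (ler0n _ _) (ler0n _ _) en
    i1 i2 i3 i4 _ sparse.
  rewrite hE ler0n => /(_ isT) h.
  have := Xi_ge_bipartite nR (ler0n _ _) (ltW hG) ltac:(lra).
  by move: h hc ee gn; set g := m%:R^-1; lra.
have h := optimise_dense nR g0 (ler0n _ _) (ler0n _ _) (ler0n _ _) en
    i1 i3 i4 hE (ltW dense).
have := Xi_ge_clique nR (ler0n _ _) (ltW hG) ltac:(lra).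
by move: h hc ee gn; set g := m%:R^-1; lra.
Qed.

Lemma ex_tiling_ge (R : realType) n (x : R) (G : sgraph 'I_n) : (nu H G)%:R < x ->
  (#|edges G| <= ex_tiling H n x)%N.
Proof. by move=> h; apply: (leq_bigmax_cond (F := fun G : sgraph 'I_n => #|edges G|)). Qed.

Lemma nat_below (R : realType) (x : R) : 0 < x -> exists k : nat, k%:R < x <= k%:R + 1.
Proof.
move=> x0; have ex : exists m : nat, x <= m%:R.
  by exists (Num.Def.archi_bound x); apply/ltW/archi_boundP/ltW.
case: (ex_minnP ex) => -[|k] hk mk; first by move: hk; rewrite leNgt x0.
exists k; rewrite -natr1 in hk; rewrite hk andbT ltNge; apply/negP=> /mk.
by rewrite ltnn.
Qed.

(** The error [7 n] comes from replacing [beta * n] by the largest integer below it. *)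
Lemma ex_tiling_lower (R : realType) (beta : R) (n : nat) : 0 <= beta <= 1 / 6 -> (0 < n)%N ->
  Xi beta * n%:R ^+ 2 - 7 * n%:R <= (ex_tiling H n (beta * n%:R))%:R.
Proof.
move=> /andP[b0 b6] n0; have nR : 1 <= n%:R :> R by rewrite ler1n.
have [->|bn] := eqVneq beta 0.
  have : 0 <= (ex_tiling H n (0 * n%:R : R))%:R :> R by [].
  rewrite /Xi; case: ifP => _; rewrite ?mulr0 ?expr0n ?mulr0 !mul0r; lra.
have bp : 0 < beta by rewrite lt_neqAle eq_sym bn.
have xp : 0 < beta * n%:R by rewrite mulr_gt0 // (lt_le_trans ltr01).
have [k /andP[kx xk]] := nat_below xp.
have xn : beta * n%:R <= n%:R / 6 by rewrite -(ler_pM2r (lt_le_trans ltr01 nR)) in b6; lra.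
have k0 : 0 <= k%:R :> R by [].
have k6 : (6 * k <= n)%N by rewrite -(ler_nat R) natrM; lra.
set x := beta * n%:R in xp kx xk xn *.
rewrite /Xi; case: ifP => h.
  have k3 : (3 * k <= n)%N by lia.
  have [G nG eG] := bipartite_extremal k3.
  have /ex_tiling_ge : (nu H G)%:R < x by apply: le_lt_trans kx; rewrite ler_nat.
  rewrite -(ler_nat R); apply: le_trans; rewrite eG natrM natrB // natrM.
  have -> : 3 * beta * (1 - 3 * beta) * n%:R ^+ 2 = 3 * x * (n%:R - 3 * x) by rewrite /x; ring.
  have : 0 <= (x - k%:R) * (x + k%:R) by rewrite mulr_ge0; lra.
  have : (x - k%:R) * n%:R <= 1 * n%:R by rewrite ler_wpM2r //; lra.
  nra.
have [G nG eG] := clique_extremal k6.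
have /ex_tiling_ge : (nu H G)%:R < x by apply: le_lt_trans kx; rewrite ler_nat.
rewrite -(ler_nat R); apply: le_trans.
move: eG => /(congr1 (fun x => x%:R : R)); rewrite !(natrD, natrM, natrX) => eG.
have -> : 18 * beta ^+ 2 * n%:R ^+ 2 = 18 * x ^+ 2 by rewrite /x; ring.
have : (x - k%:R) * (x + k%:R) <= 1 * (x + k%:R) by rewrite ler_wpM2r; lra.
rewrite !expr2 in eG *; nra.
Qed.

Local Open Scope classical_set_scope.
Local Open Scope ring_scope.

Theorem theorem1p3 (R : realType) (beta : R) (hbeta : 0 <= beta <= 1 / 6) :
  exists2 eps : nat -> R,
    eps @ \oo --> (0 : R) &
    forall n : nat,
      (ex_tiling H n (beta * n%:R))%:R = (Xi beta + eps n) * n%:R ^+ 2.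
Proof.
pose ex n := (ex_tiling H n (beta * n%:R))%:R : R.
exists (fun n => ex n / n%:R ^+ 2 - Xi beta); last first.
  (* The quotient is meaningless for [n = 0], but then there are no edges. *)
  case=> [|n]; last by rewrite addrC subrK divfK // expf_neq0 // pnatr_eq0.
  suff -> : ex_tiling H 0 (beta * 0%:R) = 0%N by rewrite expr0n mulr0.
  apply/eqP; rewrite -leqn0; apply/bigmax_leqP => G _; rewrite leqn0 cards_eq0.
  by apply/eqP/finset.setP=> E; rewrite finset.in_set0; apply/negP => /card_edge/eqP/cards2P[[]].
apply/cvgrPdist_le => /= e e0.
have b0 : 0 <= beta by case/andP: hbeta.
(* Large enough for the upper error [37 / m] and, through [n >= m], for [7 / n]. *)
pose m := (Num.Def.archi_bound (37 / e)).+1.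
have mR : 0 < m%:R :> R by rewrite ltr0n.
have hm : 37 / m%:R <= e.
  rewrite ler_pdivrMr // -ler_pdivrMl // mulrC; apply/ltW.
  apply: lt_trans (archi_boundP _) _; last by rewrite ltr_nat.
  by rewrite divr_ge0 // ltW.
exists (size_threshold (m ^ 2) + m)%N => // n /= hn.
have n0 : (0 < n)%N by apply: leq_trans hn; rewrite addnS.
have nR : 0 < n%:R :> R by rewrite ltr0n.
have n2 : 0 < n%:R ^+ 2 :> R by rewrite exprn_gt0.
have up := @ex_tiling_upper _ beta m n b0 isT (leq_trans (leq_addr _ _) hn).
have lo := ex_tiling_lower hbeta n0.
have h7 : 7 * n%:R <= e * n%:R ^+ 2.
  have mn : m%:R <= n%:R :> R by rewrite ler_nat (leq_trans (leq_addl _ _) hn).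
  have : 37 <= e * n%:R by move: hm; rewrite ler_pdivrMr // => /le_trans; apply; rewrite ler_pM2l.
  by move=> h; rewrite expr2 mulrA ler_pM2r //; lra.
have h37 : 37 / m%:R * n%:R ^+ 2 <= e * n%:R ^+ 2 by rewrite ler_pM2r.
rewrite sub0r normrN ler_norml; apply/andP; split.
  by rewrite lerBrDr ler_pdivlMr // mulrDl mulNr; move: lo; rewrite -/(ex n); lra.
by rewrite lerBlDr ler_pdivrMr // mulrDl; move: up; rewrite mulrDl -/(ex n); lra.
Qed.
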